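(* Let $H$ be any one of the following groups: 1) a pure braid group $PB_n$ with $n\geq 3$; 2) a non-abelian right angled Artin group; 3) a finitely generated non-abelian residually free group. Then for every proper word $w$ the set $w[H]$ is not rational in $H$.
   Context: A word is an element $w=w(x_1,\dots,x_n)$ of the free group $F(X)$ with basis $X=\{x_1,x_2,\dots\}$. For a group $G$, $w[G]=\{w(g_1,\dots,g_n) : g_1,\dots,g_n\in G\}$. The word $w$ is proper if there exist groups $G$ and $H$ such that $w[G]\neq \{1\}$ and $w[H]\neq H$. For a monoid $M$, the family $\mathrm{Rat}(M)$ of rational subsets of $M$ is the smallest family of subsets of $M$ that contains all finite subsets and is closed under union, product $L_1L_2=\{ab : a\in L_1, b\in L_2\}$, and submonoid generation $L\mapsto L^{\ast}$. A subset of a group $G$ is rational in $G$ if it belongs to $\mathrm{Rat}(G)$. $PB_n$ is the pure braid group on $n$ strands. The right angled Artin group (partially commutative group) $G(\Gamma)$ of a finite simple graph $\Gamma$ is the group generated by the vertices of $\Gamma$ subject to the relations $uv=vu$ for all adjacent vertices $u,v$. A group $H$ is residually free if for every $1\neq h\in H$ there is a homomorphism from $H$ to a free group that does not map $h$ to $1$. *)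

(* Defs.v *)
From HB Require Import structures.
From mathcomp Require Import all_boot all_fingroup.
From mathcomp Require Import generic_quotient.
From mathcomp Require Import all_classical zify.

Set Implicit Arguments.
Unset Strict Implicit.
Unset Printing Implicit Defensive.

Import Algebra.

Local Open Scope classical_set_scope.
Local Open Scope quotient_scope.
Local Open Scope group_scope.

(* A `groupType` carries a `choiceType` structure. As classical choice is
   available, every type has one, so `groupType` ranges over all groups. *)

Definition abelian_group (G : groupType) : Prop := forall x y : G, commute x y.

Definition isomorphic_groups (G H : groupType) : Prop :=
  exists f : UMagmaMorphism.type G H, bijective f.

Definition subgroup_set (G : groupType) (A : set G) : Prop :=
  [/\ A 1, forall x y, A x -> A y -> A (x * y) & forall x, A x -> A x^-1].

Definition finitely_generated (G : groupType) : Prop :=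
  exists S : set G, finite_set S /\ smallest (@subgroup_set G) S = setT.

Section Rational.
Variable M : monoidType.

Definition submonoid_set (A : set M) : Prop :=
  A 1 /\ forall x y, A x -> A y -> A (x * y).

Definition submonoid_gen (L : set M) : set M := smallest submonoid_set L.

Definition set_product (A B : set M) : set M :=
  [set x * y | x in A & y in B].

Inductive rational : set M -> Prop :=
| rational_finite A : finite_set A -> rational A
| rational_union A B : rational A -> rational B -> rational (A `|` B)
| rational_product A B : rational A -> rational B -> rational (set_product A B)
| rational_star A : rational A -> rational (submonoid_gen A).

End Rational.

(* A letter is a generator `(x, false)` or the formal inverse `(x, true)`
   of a generator. *)
Definition letter (X : Type) : Type := (X * bool)%type.

Definition pos {X : Type} (x : X) : letter X := (x, false).

Definition letter_eval (X : Type) (G : groupType) (g : X -> G) (l : letter X) :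
  G := if l.2 then (g l.1)^-1 else g l.1.

Definition string_eval (X : Type) (G : groupType) (g : X -> G)
  (s : seq (letter X)) : G := \prod_(l <- s) letter_eval g l.

Definition flip {X : Type} (l : letter X) : letter X := (l.1, ~~ l.2).

Definition string_inv {X : Type} (s : seq (letter X)) : seq (letter X) :=
  rev (map flip s).

Section Presentation.
Variables (X : choiceType) (R : seq (letter X) -> seq (letter X) -> Prop).

(* `R u v` means that `u = v` is one of the defining relations. *)
Inductive pres_eq : seq (letter X) -> seq (letter X) -> Prop :=
| pres_eq_refl s : pres_eq s s
| pres_eq_sym s t : pres_eq s t -> pres_eq t s
| pres_eq_trans s t u : pres_eq s t -> pres_eq t u -> pres_eq s u
| pres_eq_cancel s t l : pres_eq (s ++ [:: l; flip l] ++ t) (s ++ t)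
| pres_eq_rel s t u v : R u v -> pres_eq (s ++ u ++ t) (s ++ v ++ t).

Definition pres_eqb (s t : seq (letter X)) : bool := `[< pres_eq s t >].

Lemma pres_eqb_refl : reflexive pres_eqb.
Proof. by move=> s; apply/asboolP; exact: pres_eq_refl. Qed.

Lemma pres_eqb_sym : symmetric pres_eqb.
Proof. by move=> s t; apply/asboolP/asboolP; exact: pres_eq_sym. Qed.

Lemma pres_eqb_trans : transitive pres_eqb.
Proof.
move=> t s u /asboolP st /asboolP tu; apply/asboolP.
exact: pres_eq_trans st tu.
Qed.

Canonical pres_equiv : equiv_rel (seq (letter X)) :=
  EquivRel pres_eqb pres_eqb_refl pres_eqb_sym pres_eqb_trans.

Definition pres_group : Type := {eq_quot pres_equiv}.

HB.instance Definition _ := Choice.copy pres_group {eq_quot pres_equiv}.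

Definition pres_class (s : seq (letter X)) : pres_group :=
  \pi_{eq_quot pres_equiv} s.

Definition pres_repr (x : pres_group) : seq (letter X) :=
  repr (x : {eq_quot pres_equiv}).

Lemma pres_class_eq s t : pres_class s = pres_class t <-> pres_eq s t.
Proof. by split=> [/eqquotP/asboolP|st] //; apply/eqquotP/asboolP. Qed.

Lemma pres_reprK x : pres_class (pres_repr x) = x.
Proof. exact: reprK. Qed.

Lemma pres_classK s : pres_eq (pres_repr (pres_class s)) s.
Proof. by apply/pres_class_eq; rewrite pres_reprK. Qed.

Lemma pres_eq_ctx p q s t : pres_eq s t -> pres_eq (p ++ s ++ q) (p ++ t ++ q).
Proof.
elim=> {s t} [s|s t _|s t u _ IH1 _ IH2|s t l|s t u v Ruv].
- exact: pres_eq_refl.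
- exact: pres_eq_sym.
- exact: pres_eq_trans IH1 IH2.
- rewrite -!catA (catA p) (catA p s (t ++ q)); exact: (pres_eq_cancel (p ++ s)).
- by rewrite -!catA !(catA p s); exact: (pres_eq_rel (p ++ s) (t ++ q) Ruv).
Qed.

Lemma pres_eq_cat s s' t t' :
  pres_eq s s' -> pres_eq t t' -> pres_eq (s ++ t) (s' ++ t').
Proof.
move=> ss' tt'; apply: (@pres_eq_trans _ (s' ++ t)).
  exact: (pres_eq_ctx [::] t ss').
by have := pres_eq_ctx s' [::] tt'; rewrite !cats0.
Qed.

Lemma flipK : involutive (@flip X).
Proof. by case=> x b; rewrite /flip /= negbK. Qed.

Lemma string_invK : involutive (@string_inv X).
Proof. by move=> s; rewrite /string_inv map_rev revK (mapK flipK). Qed.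

Lemma pres_eq_mulV s : pres_eq (s ++ string_inv s) [::].
Proof.
elim/last_ind: s => [|s l IH]; first exact: pres_eq_refl.
rewrite /string_inv map_rcons rev_rcons cat_rcons -cat1s -[flip l :: _]cat1s.
by apply: pres_eq_trans IH; exact: pres_eq_cancel.
Qed.

Lemma pres_eq_Vmul s : pres_eq (string_inv s ++ s) [::].
Proof. by have := pres_eq_mulV (string_inv s); rewrite string_invK. Qed.

Definition pres_mul (x y : pres_group) : pres_group :=
  pres_class (pres_repr x ++ pres_repr y).

Definition pres_inv (x : pres_group) : pres_group :=
  pres_class (string_inv (pres_repr x)).

Definition pres_one : pres_group := pres_class [::].

Fact pres_mulA : associative pres_mul.
Proof.
move=> x y z; apply/pres_class_eq.
apply: (@pres_eq_trans _ (pres_repr x ++ pres_repr y ++ pres_repr z)).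
  by apply: pres_eq_cat; [exact: pres_eq_refl|exact: pres_classK].
rewrite catA; apply: pres_eq_cat; last exact: pres_eq_refl.
exact/pres_eq_sym/pres_classK.
Qed.

Fact pres_mul1 : left_id pres_one pres_mul.
Proof.
move=> x; rewrite -[RHS]pres_reprK; apply/pres_class_eq.
rewrite -[X in pres_eq _ X]cat0s.
by apply: pres_eq_cat; [exact: pres_classK|exact: pres_eq_refl].
Qed.

Fact pres_mulr1 : right_id pres_one pres_mul.
Proof.
move=> x; rewrite -[RHS]pres_reprK; apply/pres_class_eq.
rewrite -[X in pres_eq _ X]cats0.
by apply: pres_eq_cat; [exact: pres_eq_refl|exact: pres_classK].
Qed.

Fact pres_mulV : left_inverse pres_one pres_inv pres_mul.
Proof.
move=> x; apply/pres_class_eq; apply: pres_eq_trans (pres_eq_Vmul (pres_repr x)).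
by apply: pres_eq_cat; [exact: pres_classK|exact: pres_eq_refl].
Qed.

Fact pres_mulrV : right_inverse pres_one pres_inv pres_mul.
Proof.
move=> x; apply/pres_class_eq; apply: pres_eq_trans (pres_eq_mulV (pres_repr x)).
by apply: pres_eq_cat; [exact: pres_eq_refl|exact: pres_classK].
Qed.

HB.instance Definition _ := isGroup.Build pres_group
  pres_mulA pres_mul1 pres_mulr1 pres_mulV pres_mulrV.

Definition pres_gen (x : X) : pres_group := pres_class [:: pos x].

(* Extends `g : X -> G` to the homomorphism from the presented group to `G`;
   meaningful only if `g` satisfies the relations (see `pres_liftM`). *)
Definition pres_lift (G : groupType) (g : X -> G) (x : pres_group) : G :=
  string_eval g (pres_repr x).

Section Lift.
Variables (G : groupType) (g : X -> G).
Hypothesis gR : forall u v, R u v -> string_eval g u = string_eval g v.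

Lemma string_eval_cat s t :
  string_eval g (s ++ t) = string_eval g s * string_eval g t.
Proof. exact: big_cat. Qed.

Lemma string_eval_pres_eq s t :
  pres_eq s t -> string_eval g s = string_eval g t.
Proof.
elim=> {s t} [//|//|s t u _ -> _ -> //|s t l|s t u v Ruv].
  rewrite !string_eval_cat; congr (_ * _).
  rewrite /string_eval !big_cons big_nil mulg1 /flip /letter_eval /=.
  by case: l => x [] /=; rewrite ?mulgV ?mulVg mul1g.
by rewrite !string_eval_cat (gR Ruv).
Qed.

Lemma pres_lift_class s : pres_lift g (pres_class s) = string_eval g s.
Proof. exact/string_eval_pres_eq/pres_classK. Qed.

Lemma pres_liftM : {morph pres_lift g : x y / x * y}.
Proof. by move=> x y; rewrite [LHS]pres_lift_class string_eval_cat. Qed.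

Lemma pres_lift_gen x : pres_lift g (pres_gen x) = g x.
Proof. by rewrite pres_lift_class /string_eval big_seq1. Qed.

End Lift.
End Presentation.

Definition free_group (X : choiceType) : groupType :=
  @pres_group X (fun _ _ => False).

Definition residually_free (H : groupType) : Prop :=
  forall h : H, h <> 1 ->
    exists (X : choiceType) (f : UMagmaMorphism.type H (free_group X)), f h <> 1.

(* The variable x_(i+1) is the free generator of index `i : nat`. *)
Definition word : Type := free_group nat.

(* The value of `w` when `g i` is substituted for the generator of index `i`;
   it depends only on the values of `g` at the variables occurring in `w`. *)
Definition word_value (G : groupType) (w : word) (g : nat -> G) : G :=
  pres_lift g w.
Arguments word_value [G].

Definition verbal_set (w : word) (G : groupType) : set G :=
  [set word_value w g | g in [set: nat -> G]].
Arguments verbal_set : clear implicits.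

Definition proper_word (w : word) : Prop :=
  (exists G : groupType, verbal_set w G <> [set 1]) /\
  (exists H : groupType, verbal_set w H <> [set: H]).

Inductive raag_rel (V : finType) (e : rel V) :
  seq (letter V) -> seq (letter V) -> Prop :=
| raag_comm u v : e u v -> raag_rel e [:: pos u; pos v] [:: pos v; pos u].

Definition raag (V : finType) (e : rel V) : groupType :=
  pres_group (raag_rel e).

(* Artin's presentation of the braid group on `n` strands: the strands are
   indexed by `'I_n`, and the generator of index `i : 'I_n.-1` crosses the
   strands at positions `i` and `i.+1`. *)
Inductive braid_rel (n : nat) :
  seq (letter 'I_n.-1) -> seq (letter 'I_n.-1) -> Prop :=
| braid_far (i j : 'I_n.-1) : i.+1 < j ->
    braid_rel [:: pos i; pos j] [:: pos j; pos i]
| braid_near (i j : 'I_n.-1) : i.+1 = j ->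
    braid_rel [:: pos i; pos j; pos i] [:: pos j; pos i; pos j].

Definition braid_group (n : nat) : groupType := pres_group (@braid_rel n).

Lemma ltn_pred_S i n : i < n.-1 -> i.+1 < n.
Proof. by case: n. Qed.

Definition strand_left n (i : 'I_n.-1) : 'I_n :=
  Ordinal (ltnW (ltn_pred_S (ltn_ord i))).

Definition strand_right n (i : 'I_n.-1) : 'I_n :=
  Ordinal (ltn_pred_S (ltn_ord i)).

Definition crossing_perm n (i : 'I_n.-1) : 'S_n :=
  tperm (strand_left i) (strand_right i).

Definition braid_perm (n : nat) : braid_group n -> 'S_n :=
  pres_lift (@crossing_perm n).

Lemma crossing_perm_rel n u v : @braid_rel n u v ->
  string_eval (@crossing_perm n) u = string_eval (@crossing_perm n) v.
Proof.
have neq (a b : 'I_n) : (a < b)%N || (b < a)%N -> a != b.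
  by apply: contraL => /eqP ->; rewrite ltnn.
have eqJ (x y : 'I_n) (s : 'S_n) : tperm x y * s * tperm x y = s ^ tperm x y.
  by rewrite /conjg tpermV mulgA.
case=> i j ij; rewrite /string_eval !big_cons big_nil !mulg1 /letter_eval /=.
  rewrite [LHS]conjgC; congr (_ * _).
  rewrite /crossing_perm tpermJ !tpermD //; apply: neq; rewrite /=; lia.
rewrite !mulgA !eqJ.
have sij : strand_left j = strand_right i by apply/val_inj; rewrite /= ij.
rewrite /crossing_perm !tpermJ sij tpermL tpermR !tpermD //; apply: neq; rewrite /=; lia.
Qed.

Fact braid_perm_is_monoid_morphism n : monoid_morphism (@braid_perm n).
Proof.
split; last exact: pres_liftM (@crossing_perm_rel n).
by rewrite [LHS](pres_lift_class (@crossing_perm_rel n)) /string_eval big_nil.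
Qed.

HB.instance Definition _ n :=
  isUMagmaMorphism.Build (braid_group n) 'S_n (@braid_perm n)
    (@braid_perm_is_monoid_morphism n).

Definition pure_braid_pred (n : nat) : pred (braid_group n) :=
  fun x => braid_perm x == 1.
Arguments pure_braid_pred : clear implicits.

Fact pure_braid_group_closed n : group_closed (pure_braid_pred n).
Proof.
split=> [|x y /eqP x1 /eqP y1]; apply/eqP; first exact: gmulf1.
by rewrite gmulfF /= x1 y1 divg1.
Qed.

Definition pure_braid_group (n : nat) : Type :=
  {x : braid_group n | pure_braid_pred n x}.

HB.instance Definition _ n := SubChoice.on (pure_braid_group n).
HB.instance Definition _ n :=
  SubChoice_isSubGroup.Build (braid_group n) (pure_braid_pred n)
    (pure_braid_group n) (pure_braid_group_closed n).

(* Main.v *)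
Require Import Defs.
From mathcomp Require Import all_boot all_fingroup.
From mathcomp Require Import all_classical.
From mathcomp Require Import ssralg ssrint zify.

(** Every group [H] of the statement has a homomorphism [f] to a free group [F]
    whose image is not abelian.  For a residually free group this is immediate
    from a nontrivial commutator; a right angled Artin group maps onto the free
    group on two non-adjacent vertices; for a pure braid group one follows the
    first three strands and divides by the full twist.  As homomorphic images
    of rational sets are rational, it is enough to see that the image of
    [w[H]], which is contained in [w[F]], is not rational in [F].

    In any monoid, a rational set [R] either contains [a * Mon(x, y) * b] for
    some [x], [y] that do not commute, where [Mon(x, y)] is the submonoid that
    they generate, or is obtained by unions and products from commuting sets
    ([rational_dichotomy]).  Both cases are excluded by looking at patterns in
    reduced words.  After a conjugation, two elements of [F] that do not
    commute produce reduced words [q] and [z] such that products of [q]'s and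
    [z]'s are reduced as they stand and [q], [z] do not commute
    ([positive_sandwich]).  The word [z q^n z] contains a maximal stretch of
    period [|q|], which together with its two boundary letters is a pattern
    [U_n] ([isolated_around], [blocks_exist]).  A cut of a word meets the
    occurrences of at most [|q| + 1] of the patterns [U_n], however many of
    them are considered ([few_straddle]).

    First case.  Let [excess_n] count the occurrences of [U_n] in the reduced
    form of an element minus those in the reduced form of its inverse.  It is
    additive on a product up to a set of indices [n] of bounded size, so that
    [excess_n (w(g))] is the exponent sum of [w] weighted by [excess_n (g_i)]
    for all but boundedly many [n].  On the product of the [z q^n z] over a
    long list of [n], all these excesses are equal to [1].  If
    [a * Mon(x, y) * b] were contained in [w[F]], the weighted exponent sum of
    [w] would thus take the value [1]; but then [w] takes all values in every
    group, since powers of a single element commute, and [w] is not proper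
    ([no_sandwich]).

    Second case.  Elements of a commuting set are conjugate, by one fixed
    element, to words of a fixed period, up to inversion, and contain only
    boundedly many of the patterns; this is inherited by unions and products
    ([few_hits_bounded]).  But [w] is not trivial, and substituting for its
    variables words [m_i M m_i], where [M] contains as many patterns as
    desired and the [m_i] are distinct blocks [z q^n z], gives a value of [w]
    in which [M] survives all cancellation ([many_runs_in_value]). *)

Set Implicit Arguments.
Unset Strict Implicit.
Unset Printing Implicit Defensive.

Import Algebra.

(** * Exceptional sets of bounded size *)

(** Errors are controlled only outside of such sets of indices; what matters is
    that [C] never depends on the number of patterns that are counted. *)
Record few (C : nat) (P : nat -> Prop) : Prop := Few {
  few_size : forall s : seq nat, uniq s -> (forall j, j \in s -> P j) -> size s <= C }.

Lemma few_sub C (P Q : nat -> Prop) :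
  few C Q -> (forall j, P j -> Q j) -> few C P.
Proof. by move=> fQ PQ; split=> s us sP; apply: (few_size fQ) => // j /sP /PQ. Qed.

Lemma few_leq C D (P : nat -> Prop) : few C P -> C <= D -> few D P.
Proof. by move=> fP CD; split=> s us sP; exact: leq_trans (few_size fP us sP) CD. Qed.

Lemma few_or C D (P Q : nat -> Prop) :
  few C P -> few D Q -> few (C + D) (fun j => P j \/ Q j).
Proof.
move=> fP fQ; split=> s us sPQ.
rewrite -(count_predC (fun j => `[< P j >]) s) -!size_filter; apply: leq_add.
  apply: (few_size fP) (filter_uniq _ us) _ => j.
  by rewrite mem_filter => /andP[/asboolP].
apply: (few_size fQ) (filter_uniq _ us) _ => j.
by rewrite mem_filter /= => /andP[/asboolPn nP] /sPQ [].
Qed.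

Lemma few_inj C (P : nat -> Prop) (f : nat -> nat) :
  (forall j, P j -> f j < C) ->
  (forall i j, P i -> P j -> f i = f j -> i = j) -> few C P.
Proof.
move=> fC finj; split=> s us sP; rewrite -(size_map f) -(size_iota 0 C).
apply: uniq_leq_size => [|k /mapP[j js ->]].
  by rewrite map_inj_in_uniq // => i j /sP Pi /sP Pj; exact: finj.
by rewrite mem_iota add0n /=; exact/fC/sP.
Qed.

Lemma few_lt C : few C (fun j => j < C).
Proof. exact: (@few_inj _ _ id). Qed.

(** * Occurrences of patterns in strings *)

Section Strings.
Variables (T : eqType) (x0 : T).
Implicit Types s t u v L R : seq T.

Definition occurs u i s := prefix u (drop i s).

Definition occ u s := count (fun i => occurs u i s) (iota 0 (size s)).

Definition straddle u s t :=
  has (fun i => (size s < i + size u) && occurs u i (s ++ t)) (iota 0 (size s)).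

Lemma occurs_mid L u R : occurs u (size L) (L ++ u ++ R).
Proof. by rewrite /occurs drop_size_cat // prefix_prefix. Qed.

Lemma occurs_infix u i s : occurs u i s -> infix u s.
Proof. by move/prefixW/infix_trans; apply; exact: infix_drop. Qed.

Lemma occurs_size u i s : 0 < size u -> occurs u i s -> i + size u <= size s.
Proof. by move=> u0 /size_prefix; rewrite size_drop; lia. Qed.

Lemma occurs_nth u i s k :
  k < size u -> occurs u i s -> nth x0 s (i + k) = nth x0 u k.
Proof. by move=> ku /prefixP[R e]; rewrite -nth_drop e nth_cat ku. Qed.

Lemma infix_occurs u s : infix u s -> exists2 i, i + size u <= size s & occurs u i s.
Proof.
move=> /infixP[L [R ->]]; exists (size L); first by rewrite !size_cat; lia.
by rewrite /occurs drop_size_cat // prefix_prefix.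
Qed.

Lemma occ_gt0 u s : 0 < size u -> (0 < occ u s) = infix u s.
Proof.
move=> u0; rewrite -has_count; apply/hasP/idP => [[i _]|].
  exact: occurs_infix.
by move=> /infix_occurs[i il ui]; exists i => //; rewrite mem_iota; lia.
Qed.

Lemma occ_unique u k s : 0 < size u ->
  occurs u k s -> (forall i, occurs u i s -> i = k) -> occ u s = 1.
Proof.
move=> u0 uk uniq_k; rewrite /occ (@eq_count _ _ (pred1 k)).
  rewrite count_uniq_mem ?iota_uniq // mem_iota.
  by have := occurs_size u0 uk; lia.
by move=> i /=; apply/idP/eqP => [/uniq_k|->].
Qed.

Lemma occ_cat u s t : 0 < size u -> ~~ straddle u s t ->
  occ u (s ++ t) = occ u s + occ u t.
Proof.
move=> u0 /hasPn nst; rewrite /occ size_cat iotaD count_cat; congr (_ + _).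
  apply: eq_in_count => i ii; have := nst i ii; rewrite negb_and -leqNgt.
  have il : i <= size s by move: ii; rewrite mem_iota; lia.
  case/orP=> [le_s|/negbTE nocc].
    rewrite /occurs drop_cat ltn_neqAle il andbT; case: eqP => [ei|_].
      by exfalso; lia.
    by rewrite !prefixE takel_cat // size_drop; lia.
  rewrite nocc; apply/esym/negbTE; apply: contraFN nocc.
  rewrite /occurs drop_cat ltn_neqAle il andbT; case: eqP => [ei|_].
    by rewrite ei drop_size; case: (u) u0.
  exact: prefix_catl.
rewrite add0n -{1}[size s]addn0 iotaDl count_map; apply: eq_count => i /=.
by rewrite /occurs drop_cat ltnNge leq_addr /= addKn.
Qed.

Variable p : nat.

Definition agrees s i := nth x0 s i == nth x0 s (i + p).

(** A maximal stretch of period [p], with one letter more on either side to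
    witness that it cannot be prolonged: [u] agrees with its shift by [p]
    except at the first and the last place where the two can be compared. *)
Definition isolated u :=
  [/\ p.+2 <= size u, ~~ agrees u 0, ~~ agrees u (size u - p.+1)
    & forall i, 0 < i < size u - p.+1 -> agrees u i].

Lemma occurs_agrees u i s k : k + p < size u -> occurs u i s ->
  agrees s (i + k) = agrees u k.
Proof.
move=> ku ui; rewrite /agrees -addnA !(occurs_nth _ ui) //; lia.
Qed.

Lemma isolated_size u : isolated u -> 0 < size u.
Proof. by case; lia. Qed.

(** The places where a text agrees with its shift by [p] form maximal
    intervals, and an occurrence of an isolated string singles out one of
    them.  Two occurrences whose intervals overlap single out the same one. *)
Lemma isolated_collide u v i j s : isolated u -> isolated v ->
  occurs u i s -> occurs v j s -> i <= j < i + (size u - p.+1) ->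
  i = j /\ u = v.
Proof.
move=> [u2 u0 uE ui] [v2 v0 vE vi] os ot /andP[ij ji].
have eij : i = j.
  apply/eqP; rewrite eqn_leq ij leqNgt; apply/negP => lt_ij.
  have := @occurs_agrees v j s 0 ltac:(lia) ot; rewrite (negbTE v0) addn0.
  have -> : j = i + (j - i) by lia.
  rewrite (occurs_agrees _ os); last lia.
  by rewrite ui //; lia.
split=> //; subst j.
have eE : size u = size v.
  apply/eqP; rewrite eqn_leq; apply/andP; split; rewrite leqNgt; apply/negP => lt.
    have := @occurs_agrees v i s (size v - p.+1) ltac:(lia) ot.
    by rewrite (negbTE vE) (occurs_agrees _ os) ?ui //; lia.
  have := @occurs_agrees u i s (size u - p.+1) ltac:(lia) os.
  by rewrite (negbTE uE) (occurs_agrees _ ot) ?vi //; lia.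
by move: os ot; rewrite /occurs !prefixE eE => /eqP <- /eqP.
Qed.

(** Only one interval of agreement can run across the cut; the other
    occurrences that reach beyond the cut have an interval that ends at one of
    the [p] places before it. *)
Lemma few_straddle (U : nat -> seq T) s t :
  injective U -> (forall j, isolated (U j)) ->
  few p.+1 (fun j => straddle (U j) s t).
Proof.
move=> Uinj Uiso.
have /choice[f fP] : forall j, exists i, straddle (U j) s t ->
    [/\ i < size s, size s < i + size (U j) & occurs (U j) i (s ++ t)].
  move=> j; case: (boolP (straddle _ _ _)) => [/hasP[i]|_]; last by exists 0.
  by rewrite mem_iota => ii /andP[? ?]; exists i => _; split=> //; lia.
(* The truncated distance from the end of the interval to the cut: it is 0 for
   the interval that runs across the cut. *)
apply: (@few_inj _ _ (fun j => size s - (f j + (size (U j) - p.+1)))) => [j|i j].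
  by move=> /fP[? ? _]; case: (Uiso j); lia.
move=> /fP[i1 i2 i3] /fP[j1 j2 j3] e.
have [ui _ _ _] := Uiso i; have [uj _ _ _] := Uiso j.
apply: Uinj; case: (leqP (f i) (f j)) => [ij|/ltnW ji].
  by case: (isolated_collide (Uiso i) (Uiso j) i3 j3) => //; lia.
by case: (isolated_collide (Uiso j) (Uiso i) j3 i3) => //; lia.
Qed.

(** An isolated string near an end of a text is a barrier for runs that
    would cross this end. *)
Definition lframed W s := exists L v R, [/\ s = L ++ v ++ R, isolated v & size L <= W].
Definition rframed W s := exists L v R, [/\ s = L ++ v ++ R, isolated v & size R <= W].

Lemma lframed_cat W s t : lframed W s -> lframed W (s ++ t).
Proof. by move=> [L [v [R [-> vi sL]]]]; exists L, v, (R ++ t); rewrite -!catA. Qed.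

(** The barriers on both sides of the cut leave no room for a long run. *)
Lemma straddle_framed W u s t : isolated u -> rframed W s -> lframed W t ->
  2 * W + 2 * p + 2 < size u -> ~~ straddle u s t.
Proof.
move=> ui [L [v [R [-> vi sR]]]] [L' [v' [R' [-> vi' sL']]]] bigu.
apply/hasPn => i; rewrite mem_iota => /andP[_ il]; apply/negP => /andP[ci ou].
set txt := (X in occurs _ _ X) in ou.
have ov : occurs v (size L) txt.
  by rewrite /txt -!catA; exact: occurs_mid.
have ov' : occurs v' (size (L ++ v ++ R) + size L') txt.
  have := occurs_mid ((L ++ v ++ R) ++ L') v' R'.
  by rewrite size_cat -[X in occurs _ _ X]catA.
have [v2 _ _ _] := vi; have [v2' _ _ _] := vi'.
move: il ci; rewrite !size_cat add0n => il ci; rewrite !size_cat in ov'.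
case: (leqP i (size L)) => iL.
  case: (ltnP (size L) (i + (size u - p.+1))) => h.
    by case: (isolated_collide ui vi ou ov) => [|ei eu]; [lia|rewrite eu in ci; lia].
  lia.
case: (ltnP i (size L + (size v - p.+1))) => h.
  by case: (isolated_collide vi ui ov ou) => *; lia.
case: (isolated_collide ui vi' ou ov') => *; lia.
Qed.

(** A run that is longer than the margins has to overlap [v]. *)
Lemma isolated_only W L v R u i : isolated u -> isolated v ->
  size L <= W -> size R <= W -> W + p.+1 < size u ->
  occurs u i (L ++ v ++ R) -> i = size L /\ u = v.
Proof.
move=> ui vi sL sR bigu ou; have [v2 _ _ _] := vi.
have ov := occurs_mid L v R.
have := occurs_size (isolated_size ui) ou; rewrite !size_cat => sz.
case: (leqP i (size L)) => iL.
  by case: (isolated_collide ui vi ou ov) => [|-> ->] //; lia.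
by case: (isolated_collide vi ui ov ou) => [|-> ->] //; lia.
Qed.

(** The run between the last disagreement before [a] and the first one from
    [e] on. *)
Lemma isolated_exists s a e : p + e < size s -> a < e ->
  (exists2 i, i < a & ~~ agrees s i) ->
  (exists2 i, e <= i < size s - p & ~~ agrees s i) ->
  (forall i, a <= i < e -> agrees s i) ->
  exists L u R, [/\ s = L ++ u ++ R, isolated u, size L < a & size R + p + e < size s].
Proof.
move=> se ae [i0 i0a ni0] [k0 k0e nk0] mid.
have exL : exists i, (i < a) && ~~ agrees s i by exists i0; apply/andP.
have exR : exists i, (e <= i < size s - p) && ~~ agrees s i by exists k0; apply/andP.
have bL i : (i < a) && ~~ agrees s i -> i <= a by move=> /andP[/ltnW].
case: (ex_maxnP exL bL) => i /andP[ia ni] imax.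
case: (ex_minnP exR) => k /andP[ke nk] kmin.
have su : size (take (k - i + p.+1) (drop i s)) = k - i + p.+1.
  by rewrite size_takel // size_drop; lia.
exists (take i s), (take (k - i + p.+1) (drop i s)), (drop (k + p.+1) s).
have tk : drop (k + p.+1) s = drop (k - i + p.+1) (drop i s).
  by rewrite drop_drop; congr drop; lia.
have E : s = take i s ++ take (k - i + p.+1) (drop i s) ++ drop (k + p.+1) s.
  by rewrite tk !cat_take_drop.
split=> //; last 2 first.
- by rewrite size_takel //; lia.
- by rewrite size_drop; lia.
have ag j : j + p < k - i + p.+1 ->
    agrees (take (k - i + p.+1) (drop i s)) j = agrees s (i + j).
  by move=> jl; rewrite /agrees !nth_take ?nth_drop ?addnA //; lia.
split; rewrite ?su.
- lia.
- by rewrite ag ?addn0 //; lia.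
- by rewrite ag; [have -> : i + (k - i + p.+1 - p.+1) = k by lia|lia].
- move=> j jb; rewrite ag; last lia.
  case: (ltnP (i + j) a) => h1.
    by apply: contraT => nj; have := imax (i + j); rewrite h1 nj; lia.
  case: (ltnP (i + j) e) => h2; first by apply: mid; rewrite h1.
  apply: contraT => nj; have := kmin (i + j); rewrite nj h2 /=; lia.
Qed.

End Strings.

(** * Reduced words *)

Lemma pres_class_cat (T : choiceType) R (s t : seq (letter T)) :
  pres_class R (s ++ t) = (pres_class R s * pres_class R t)%g.
Proof.
by apply/pres_class_eq/pres_eq_sym; apply: pres_eq_cat; exact: pres_classK.
Qed.

Section Reduced.
Variable X : choiceType.
Implicit Types (a b : letter X) (r s t u : seq (letter X)).

Definition reduced s := sorted (fun a b => b != flip a) s.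

Definition push a s :=
  if s is b :: s' then if b == flip a then s' else a :: s else [:: a].

Definition normalize s := foldr push [::] s.

Lemma flip_inj : injective (@flip X).
Proof. exact: inv_inj (@flipK X). Qed.

Lemma flip_neq a : flip a != a.
Proof. by case: a => x b; rewrite /flip xpair_eqE /= eqxx; case: b. Qed.

Lemma string_inv_cat s t : string_inv (s ++ t) = string_inv t ++ string_inv s.
Proof. by rewrite /string_inv map_cat rev_cat. Qed.

Lemma size_string_inv s : size (string_inv s) = size s.
Proof. by rewrite size_rev size_map. Qed.

Lemma string_inv_cons a s : string_inv (a :: s) = rcons (string_inv s) (flip a).
Proof. by rewrite /string_inv /= rev_cons. Qed.

Lemma string_inv_rcons a s : string_inv (rcons s a) = flip a :: string_inv s.
Proof. by rewrite /string_inv map_rcons rev_rcons. Qed.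

Lemma reduced_inv s : reduced (string_inv s) = reduced s.
Proof.
rewrite /reduced /string_inv rev_sorted sorted_map; apply: eq_sorted => a b /=.
by rewrite flipK eq_sym -(inj_eq flip_inj) flipK eq_sym.
Qed.

Lemma reduced_rcons_cons s a b t :
  reduced (rcons s a ++ b :: t) =
  [&& reduced (rcons s a), reduced (b :: t) & b != flip a].
Proof.
rewrite /reduced; case: s => [|c s] /=; first by rewrite andbC.
rewrite cat_path last_rcons /=; by rewrite [X in _ && X]andbC.
Qed.

Lemma reduced_catl s t : reduced (s ++ t) -> reduced s.
Proof. by rewrite /reduced; case: s => //= a s; rewrite cat_path => /andP[]. Qed.

Lemma reduced_catr s t : reduced (s ++ t) -> reduced t.
Proof.
by rewrite /reduced; case: s => //= a s; rewrite cat_path => /andP[_ /path_sorted].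
Qed.

Lemma reduced_glue s u t : u != [::] ->
  reduced (s ++ u) -> reduced (u ++ t) -> reduced (s ++ u ++ t).
Proof.
case: t => [|b t]; first by rewrite cats0.
case/lastP: u => [//|u a] _; rewrite -cats1 !catA cats1 reduced_rcons_cons => ->.
by rewrite cats1 reduced_rcons_cons => /and3P[_ -> ->].
Qed.

Lemma reduced_infix s t : infix s t -> reduced t -> reduced s.
Proof. by move=> /infixP[u [v ->]] /reduced_catr /reduced_catl. Qed.

Lemma reduced_push a s : reduced s -> reduced (push a s).
Proof.
case: s => //= b s rs; case: ifPn => [_|ba]; first exact: (@reduced_catr [:: b]).
by rewrite /reduced /= ba.
Qed.

Lemma push_flipK a s : reduced s -> push a (push (flip a) s) = s.
Proof.
case: s => [|b s] /=; first by rewrite eqxx.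
rewrite flipK; case: eqP => [-> {b}|ba _] /=; last by rewrite eqxx.
by case: s => //= b s /andP[/negbTE ->].
Qed.

Lemma reduced_foldr r s : reduced r -> reduced (foldr push r s).
Proof. by move=> rr; elim: s => //= a s; exact: reduced_push. Qed.

(** Pushing letters is an action of the free group on the reduced strings, so
    strings that represent the same element act in the same way.  Applied to
    the empty string, this is the uniqueness of reduced forms. *)
Lemma foldr_push_pres_eq r s t : pres_eq (fun _ _ => False) s t -> reduced r ->
  foldr push r s = foldr push r t.
Proof.
elim=> {s t} [//|s t _ IH /IH ->//|s t u _ IH1 _ IH2 rr|s t a rr|//].
  by rewrite IH1 ?IH2.
by rewrite !foldr_cat /= push_flipK //; exact: reduced_foldr.
Qed.

Lemma foldr_push_reduced s t : reduced (s ++ t) -> foldr push t s = s ++ t.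
Proof.
elim: s => //= a s IH rs; rewrite IH; last exact: (@reduced_catr [:: a]).
by case: (s ++ t) rs => //= b v /andP[/negbTE ->].
Qed.

Lemma normalize_reduced s : reduced s -> normalize s = s.
Proof. by move=> rs; rewrite /normalize foldr_push_reduced ?cats0. Qed.

Lemma pres_eq_normalize s : pres_eq (fun _ _ => False) (normalize s) s.
Proof.
elim: s => [|a s IH] /=; first exact: pres_eq_refl.
apply: (@pres_eq_trans _ _ _ (a :: normalize s)); last first.
  exact: (pres_eq_cat (pres_eq_refl _ [:: a]) IH).
rewrite /normalize /=; case: (foldr _ _ s) => [|b t] /=; first exact: pres_eq_refl.
case: eqP => [->|_]; last exact: pres_eq_refl.
apply: pres_eq_sym; exact: (pres_eq_cancel _ [::] t a).
Qed.

Definition fclass s : free_group X := pres_class (fun _ _ => False) s.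

Definition red (x : free_group X) : seq (letter X) := normalize (pres_repr x).

Lemma red_reduced x : reduced (red x).
Proof. exact: reduced_foldr. Qed.

Lemma redK : cancel red fclass.
Proof.
move=> x; rewrite -[RHS]pres_reprK; apply/pres_class_eq; exact: pres_eq_normalize.
Qed.

Lemma red_fclass s : red (fclass s) = normalize s.
Proof. by apply: foldr_push_pres_eq => //; exact: pres_classK. Qed.

Lemma fclassK s : reduced s -> red (fclass s) = s.
Proof. by move=> rs; rewrite red_fclass normalize_reduced. Qed.

Lemma fclass_cat s t : fclass (s ++ t) = (fclass s * fclass t)%g.
Proof. exact: pres_class_cat. Qed.

Lemma fclass_inv s : fclass (string_inv s) = (fclass s)^-1%g.
Proof.
apply: (@mulgI _ (fclass s)); rewrite mulgV -fclass_cat.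
by apply/pres_class_eq; exact: pres_eq_mulV.
Qed.

Lemma fclass_nil : fclass [::] = 1%g.
Proof. by []. Qed.

Lemma red1 : red 1%g = [::].
Proof. by rewrite -fclass_nil fclassK. Qed.

Lemma redV x : red (x^-1)%g = string_inv (red x).
Proof. by rewrite -{1}(redK x) -fclass_inv fclassK // reduced_inv red_reduced. Qed.

(** In a product of two reduced strings everything cancels at the junction. *)
Lemma reduced_cancel s t : reduced s -> reduced t ->
  exists s' c t', [/\ s = s' ++ c, t = string_inv c ++ t' & reduced (s' ++ t')].
Proof.
elim/last_ind: s t => [|s a IH] t rs rt; first by exists [::], [::], t.
case: t rt => [|b t] rt; first by exists (rcons s a), [::], [::]; rewrite !cats0.
have [ba|ba] := eqVneq b (flip a); last first.
  exists (rcons s a), [::], (b :: t); split; rewrite ?cats0 //.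
  by rewrite reduced_rcons_cons rs rt ba.
have [|//|s' [c [t' [-> -> r']]]] := IH t.
- by move: rs; rewrite -cats1 => /reduced_catl.
- exact: (@reduced_catr [:: b]).
- exists s', (rcons c a), t'; split=> //; first by rewrite rcons_cat.
  by rewrite string_inv_rcons ba.
Qed.

Lemma red_mul x y :
  exists s c t, [/\ red x = s ++ c, red y = string_inv c ++ t & red (x * y)%g = s ++ t].
Proof.
have [s [c [t [xe ye rst]]]] := reduced_cancel (red_reduced x) (red_reduced y).
exists s, c, t; split=> //.
rewrite -(redK x) -(redK y) xe ye !fclass_cat fclass_inv mulgA mulgK -fclass_cat.
by rewrite fclassK.
Qed.

Lemma reduced_inv_eq s : reduced s -> string_inv s = s -> s = [::].
Proof.
have [n] := ubnP (size s); elim: n s => // n IH [//|a s] /=.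
case/lastP: s => [|s b] sn rs.
  by rewrite /string_inv /= => -[] /eqP; rewrite (negbTE (flip_neq a)).
rewrite string_inv_cons string_inv_rcons => -[ba /eqP].
rewrite eqseq_rcons => /andP[/eqP e _]; exfalso.
have s0 : s = [::].
  apply: IH e; first by move: sn; rewrite size_rcons; lia.
  by apply: (@reduced_catl _ [:: b]); rewrite cats1; exact: (@reduced_catr [:: a]).
by move: rs; rewrite s0 /reduced /= -ba flipK eqxx.
Qed.

End Reduced.

(** * Periodic strings *)

Section Powers.
Variables (T : eqType) (x0 : T).
Implicit Types q s u : seq T.

Definition spow q n : seq T := flatten (nseq n q).

Lemma spowS q n : spow q n.+1 = q ++ spow q n.
Proof. by []. Qed.

Lemma spowSr q n : spow q n.+1 = spow q n ++ q.
Proof.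
elim: n => [|n IH]; first by rewrite /spow /= cats0.
by rewrite spowS {1}IH catA -spowS.
Qed.

Lemma size_spow q n : size (spow q n) = n * size q.
Proof. by elim: n => [//|n IH]; rewrite spowS size_cat IH mulSn. Qed.

Lemma nth_spow q n k : k < n * size q ->
  nth x0 (spow q n.+1) (k + size q) = nth x0 (spow q n.+1) k.
Proof.
move=> kn; rewrite {1}spowS nth_cat ltnNge leq_addl /= addnK.
by rewrite spowSr nth_cat size_spow kn.
Qed.

Lemma infix_spow_rot q s n : size s = size q -> infix s (spow q n) ->
  exists i, s = rot i q.
Proof.
move=> ss; elim: n => [|n IH].
  by rewrite infixs0 => /eqP s0; exists 0; move: ss; rewrite s0 => /esym/size0nil->.
move=> /infix_occurs[i]; rewrite spowS size_cat size_spow ss => il os.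
case: (ltnP i (size q)) => iq; last first.
  move: os; rewrite /occurs drop_cat ltnNge iq /= => os; apply: IH.
  exact: occurs_infix os.
case: n il os {IH} => [|n] il.
  have -> : i = 0 by lia.
  rewrite /occurs drop0 cats0 => /prefixP[r e]; exists 0; rewrite rot0 e.
  by move/(congr1 size): e; rewrite size_cat ss; case: r; rewrite ?cats0 //=; lia.
rewrite /occurs drop_cat iq prefixE ss spowS => /eqP <-; exists i.
rewrite take_cat size_drop ifN; last by lia.
rewrite /rot; congr (_ ++ _); rewrite takel_cat; last lia.
by congr take; lia.
Qed.

Lemma infix_spow_long q s n : infix s (spow q n) -> 2 * size q <= size s ->
  infix q s.
Proof.
elim: n => [|n IH]; first by rewrite infixs0 => /eqP -> /=; case: q => //=; lia.
move=> /infix_occurs[i]; rewrite spowS size_cat size_spow => il os ss.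
case: (ltnP i (size q)) => iq; last first.
  move: os; rewrite /occurs drop_cat ltnNge iq /= => os.
  exact: IH (occurs_infix os) ss.
case: n il os {IH} => [|n] il; first lia.
rewrite /occurs drop_cat iq prefixE spowS => /eqP <-.
rewrite take_cat size_drop ifN; last by lia.
rewrite take_cat ifN; last by lia.
exact: infix_infix.
Qed.

(** Copies of [q] can be removed from the front of [s] one after another. *)
Lemma commuting_strings_prefix q s : q != [::] -> s ++ q = q ++ s ->
  prefix s (spow q (size s)).
Proof.
move=> q0; have [n] := ubnP (size s); elim: n s => // n IH s sn e.
case: (leqP (size s) (size q)) => sq.
  case: (posnP (size s)) => [/size0nil->//|s0]; rewrite -(prednK s0) spowS.
  apply: prefix_catl; have : prefix s (q ++ s) by rewrite -e prefix_prefix.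
  by rewrite !prefixE takel_cat.
have es : s = q ++ drop (size q) s.
  have tq : take (size q) s = q.
    by rewrite -(takel_cat q (ltnW sq)) e take_size_cat.
  by rewrite -{1}(cat_take_drop (size q) s) tq.
have q1 : 0 < size q by case: (q) q0.
set s' := drop (size q) s in es.
have e' : s' ++ q = q ++ s'.
  by move/eqP: e; rewrite es -!catA eqseq_cat // eqxx => /eqP.
have ss : size s = size q + size s' by rewrite es size_cat.
have := IH s' _ e'; rewrite es => /(_ ltac:(lia)) /prefixP[r er].
rewrite size_cat -(prednK q1) addSn spowS prefix_catr // eqxx /=.
apply: prefix_trans (_ : prefix (spow q (size s')) _); first by rewrite er prefix_prefix.
elim: (size q).-1 => [|k IHk]; rewrite ?prefix_refl //.
by rewrite addSn spowSr prefix_catl.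
Qed.

Definition periodic p s := forall i, i + p < size s -> agrees x0 p s i.

Lemma periodic_spow q n : periodic (size q) (spow q n).
Proof.
case: n => [|n] i; rewrite size_spow ?mul0n // mulSn => il.
by rewrite /agrees nth_spow //; lia.
Qed.

Lemma periodic_prefix p s u : prefix s u -> periodic p u -> periodic p s.
Proof.
move=> /prefixP[r ->] pu i il; have := pu i ltac:(rewrite size_cat; lia).
rewrite /agrees !nth_cat il; have -> // : i < size s by lia.
Qed.

(** In a text of period [d], the disagreement at the start of [u] reappears [d]
    places further, inside the run. *)
Lemma isolated_periodic p d u s : 0 < d -> isolated x0 p u -> periodic d s ->
  d + p.+1 < size u -> infix u s -> False.
Proof.
move=> d0 [_ u0 _ ui] ps du /infix_occurs[i il ou].
have h k : k + p < size u -> agrees x0 p s (i + k) = agrees x0 p u k.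
  by move=> kp; exact: occurs_agrees ou.
have a0 := h 0 ltac:(lia); have ad := h d ltac:(lia).
move: ad; rewrite ui; last lia.
have := ps i ltac:(lia); have := ps (i + p) ltac:(lia).
rewrite /agrees => /eqP e1 /eqP e2; move: a0; rewrite (negbTE u0) /agrees addn0 e1 e2.
by rewrite -!addnA (addnC p d) => ->.
Qed.

(** Were there no disagreement before the powers of [q], the string [z ++ q]
    would have period [size q] and start with [q], hence be equal to [q ++ z];
    the same holds after them.  So it is because [z] and [q] do not commute
    that the run of period [size q] stops within the two copies of [z]. *)
Lemma isolated_around q z n : z != [::] -> q != [::] -> 1 < n ->
  prefix q z -> suffix q z -> z ++ q != q ++ z ->
  exists L u R, [/\ z ++ spow q n ++ z = L ++ u ++ R, isolated x0 (size q) u,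
    size L <= size z & size R <= size z].
Proof.
move=> z0 q0 n1 qz zq nc; set p := size q.
have p0 : 0 < p by rewrite /p; case: (q) q0.
have zs : 0 < size z by case: (z) z0.
pose s := z ++ spow q n ++ z.
have ss : size s = size z + n * p + size z by rewrite !size_cat size_spow addnA.
have np : n * p = n.-1 * p + p by case: (n) n1 => //= k _; rewrite mulSn addnC.
have n1p : p <= n.-1 * p by case: (n) n1 => [|[|k]] // _; rewrite mulSn leq_addr.
have pz : p <= size z by apply: size_prefix.
have left : exists2 i, i < size z & ~~ agrees x0 p s i.
  apply/not_exists2P => all_ag; case/negP: nc; apply/eqP.
  have ag i : i < size z -> agrees x0 p s i.
    by move=> iz; apply: contraT => ni; case: (all_ag i).
  have sE : exists r, s = (z ++ q) ++ r.
    by exists (spow q n.-1 ++ z); rewrite /s -(prednK (ltnW n1)) spowS -!catA.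
  case: sE => r sE.
  rewrite -(cat_take_drop p (z ++ q)); congr (_ ++ _).
    by move: qz; rewrite prefixE takel_cat // => /eqP.
  apply: (@eq_from_nth _ x0); first by rewrite size_drop size_cat addnK.
  move=> i; rewrite size_drop size_cat -/p addnK => iz.
  have := ag i iz; rewrite /agrees nth_drop {1}/s nth_cat iz => /eqP ->.
  by rewrite sE [RHS]nth_cat size_cat addnC ltn_add2r iz.
have right : exists2 i, size z + n.-1 * p <= i < size s - p & ~~ agrees x0 p s i.
  apply/not_exists2P => all_ag; case/negP: nc; apply/eqP.
  have ag i : i < size z -> agrees x0 p s (size z + n.-1 * p + i).
    by move=> iz; apply: contraT => ni; case: (all_ag (size z + n.-1 * p + i)); lia.
  have sE : s = (z ++ spow q n.-1) ++ (q ++ z).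
    by rewrite /s -(prednK (ltnW n1)) spowSr -!catA.
  have sz : size (z ++ spow q n.-1) = size z + n.-1 * p by rewrite size_cat size_spow.
  rewrite -[RHS](cat_take_drop (size z)); congr (_ ++ _).
    apply: (@eq_from_nth _ x0); first by rewrite size_takel // size_cat; lia.
    move=> i iz; rewrite nth_take //.
    have := ag i iz; rewrite /agrees sE -!sz -[size _ + i + p]addnA.
    rewrite ![nth _ (_ ++ (q ++ z)) _]nth_cat.
    rewrite !ltnNge !leq_addr /= !addKn => /eqP ->.
    by rewrite nth_cat ltnNge leq_addl /= addnK.
  move: zq; rewrite suffixE drop_cat => /eqP {1}<-.
  case: ltnP => h; last by congr drop; rewrite -/p; lia.
  by exfalso; rewrite -/p in h; lia.
have mid i : size z <= i < size z + n.-1 * p -> agrees x0 p s i.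
  move=> ib; have -> : i = size z + (i - size z) by lia.
  rewrite /agrees /s -addnA ![nth _ (z ++ _) _]nth_cat !ltnNge !leq_addr /= !addKn.
  rewrite ![nth _ (_ ++ z) _]nth_cat size_spow -/p.
  have -> : i - size z < n * p by lia.
  have -> : i - size z + p < n * p by lia.
  by rewrite -(prednK (ltnW n1)) nth_spow //; rewrite -/p; lia.
have [||L [u [R [sE ui sL sR]]]] := isolated_exists _ _ left right mid.
- by rewrite ss; lia.
- by lia.
exists L, u, R; split=> //; first exact: ltnW.
by move: sR; rewrite ss; lia.
Qed.

End Powers.

(** * Building blocks from two elements that do not commute *)

Section FreeGroup.
Variable X : choiceType.
Local Notation F := (free_group X).
Implicit Types (a b : letter X) (q s t u z : seq (letter X)) (x y : F).

Lemma infix_inv s t : infix s t -> infix (string_inv s) (string_inv t).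
Proof.
by move=> /infixP[L [R ->]]; rewrite !string_inv_cat -catA; exact: infix_infix.
Qed.

(** A factor of length [size q] of a power of [q] is a rotation [B ++ A] of
    [q = A ++ B].  If it is the inverse of [q], both [A] and [B] are their own
    inverses, and a reduced string with this property is empty. *)
Lemma no_inverse_in_power q n : q != [::] -> reduced q ->
  ~~ infix (string_inv q) (spow q n).
Proof.
move=> q0 rq; apply/negP => /(infix_spow_rot (size_string_inv q))[i].
rewrite /rot => e; case/eqP: q0; move: rq e.
rewrite -[in X in X -> _](cat_take_drop i q).
rewrite -[in X in _ -> string_inv X = _ -> _](cat_take_drop i q).
rewrite -[X in _ -> _ -> X = _](cat_take_drop i q).
set A := take i q; set B := drop i q.
rewrite string_inv_cat => rq /eqP; rewrite eqseq_cat ?size_string_inv //.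
move=> /andP[/eqP eB /eqP eA].
by rewrite (reduced_inv_eq (reduced_catl rq) eA) (reduced_inv_eq (reduced_catr rq) eB).
Qed.

Lemma reduced_spow q n : q != [::] -> reduced (q ++ q) -> reduced (spow q n).
Proof.
move=> q0 rq; elim: n => // n IH; rewrite spowS.
case: n IH => [_|n IH]; first by rewrite cats0; exact: reduced_catl rq.
by rewrite spowS; apply: reduced_glue.
Qed.

Lemma fclass_spow q n : fclass (spow q n) = (fclass q ^+ n)%g.
Proof. by elim: n => // n IH; rewrite spowS fclass_cat IH expgS. Qed.

Lemma cyclic_reduction x : x <> 1%g ->
  exists t q, [/\ q != [::], reduced (q ++ q) & (x ^ fclass t)%g = fclass q].
Proof.
have [s [rs ->]] : exists s, reduced s /\ x = fclass s.
  by exists (red x); rewrite redK red_reduced.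
have [n] := ubnP (size s); elim: n s rs => // n IH [|a s] rs sn x1.
  by case: x1.
case/lastP: s sn rs x1 => [|s b] sn rs x1.
  exists [::], [:: a]; split=> //; last by rewrite fclass_nil conjg1.
  by rewrite /reduced /= andbT eq_sym flip_neq.
have [ba|ba] := eqVneq (flip b) a; last first.
  exists [::], (a :: rcons s b); split=> //; last by rewrite fclass_nil conjg1.
  by rewrite -[X in X ++ _]rcons_cons reduced_rcons_cons rcons_cons rs eq_sym.
have rs' : reduced s.
  by apply: (@reduced_catl _ _ [:: b]); rewrite cats1; exact: (@reduced_catr _ [:: a]).
have e : fclass (a :: rcons s b) = (fclass s ^ (fclass [:: a])^-1)%g.
  have sa : string_inv [:: a] = [:: b] by rewrite /string_inv /= -ba flipK.
  by rewrite conjgE invgK -fclass_inv sa -(fclass_cat s) -(fclass_cat [:: a]) cats1.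
have [||t [q [q0 rq tq]]] := IH s rs'.
- by move: sn; rewrite /= size_rcons; lia.
- by move=> s1; apply: x1; rewrite e s1 conj1g.
by exists (a :: t), q; split=> //; rewrite -[a :: t]cat1s fclass_cat conjgM e conjgKV.
Qed.

(** The cancellation on the left of [x] cannot go on for [2 * size q] letters
    into the power of [q] on the right of [x], as the inverse of [q] would then
    occur in a power of [q].  So for large [n], copies of [q] survive at both
    ends of the reduced form of [q ^+ n * x * q ^+ n]. *)
Lemma positive_sandwich q x : q != [::] -> reduced (q ++ q) ->
  exists n z, [/\ fclass z = (fclass q ^+ n * x * fclass q ^+ n)%g,
    reduced z, prefix q z & suffix q z].
Proof.
move=> q0 rq; pose N := size (red x) + 4.
have rqN : reduced (spow q N) by exact: reduced_spow.
have p0 : 0 < size q by case: (q) q0.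
have [u [k [s [xe qe rus]]]] := reduced_cancel (red_reduced x) rqN.
have [t [k' [r [qe' use rtr]]]] := reduced_cancel rqN rus.
have sN : size (spow q N) = N * size q by rewrite size_spow.
have s1 : size k + size s = N * size q.
  by rewrite -sN qe size_cat size_string_inv.
have s2 : size t + size k' = N * size q by rewrite -sN qe' size_cat.
have s3 : size u + size s = size k' + size r.
  by rewrite -!size_cat use !size_cat size_string_inv.
have s4 : size (red x) = size u + size k by rewrite xe size_cat.
have k'u : size k' < size u + 2 * size q.
  rewrite ltnNge; apply/negP => kb.
  have [v ve] : exists v, string_inv k' = u ++ v.
    exists (drop (size u) (string_inv k')).
    rewrite -[LHS](cat_take_drop (size u)); congr (_ ++ _).
    have kk : size u <= size (string_inv k') by rewrite size_string_inv; lia.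
    by rewrite -(takel_cat r kk) -use take_size_cat.
  have sv : s = v ++ r.
    by move/eqP: use; rewrite ve -catA eqseq_cat // eqxx => /eqP.
  case/negP: (no_inverse_in_power N q0 (reduced_catl rq)).
  apply: (@infix_trans _ (string_inv v)).
    apply: infix_inv; apply: (@infix_spow_long _ _ _ N).
      by rewrite qe sv; exact: infix_infix.
    change (2 * size q <= size v).
    by move: (congr1 size ve); rewrite size_cat size_string_inv; lia.
  apply: (@infix_trans _ k'); last by rewrite qe'; exact: suffix_infix.
  by rewrite -(string_invK k') ve string_inv_cat; exact: prefix_infix.
have Nq : size u + size k + 4 * size q <= N * size q.
  rewrite /N mulnDl leq_add2r -s4; case: (size q) p0 => // p' _.
  by rewrite mulnS leq_addr.
exists N, (t ++ r); split=> //.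
- rewrite -fclass_spow -{1}(redK x) xe !fclass_cat.
  have -> : fclass (spow q N) = (fclass t * fclass k')%g by rewrite -fclass_cat -qe'.
  have -> : (fclass t * fclass k' * (fclass u * fclass k) * (fclass t * fclass k'))%g
    = (fclass t * fclass k' * (fclass u * (fclass k * fclass (spow q N))))%g.
    by rewrite qe' fclass_cat !mulgA.
  have -> : (fclass k * fclass (spow q N))%g = fclass s.
    by rewrite qe fclass_cat fclass_inv mulVKg.
  by rewrite -(fclass_cat u) use fclass_cat fclass_inv -mulgA mulVKg.
- apply: prefix_catl; have : prefix q (spow q N) by rewrite /N addnS spowS prefix_prefix.
  have qt : size q <= size t by lia.
  by rewrite qe' !prefixE (takel_cat _ qt).
- apply: suffix_catr; have qs : suffix q s.
    have : suffix q (spow q N) by rewrite /N addnS spowSr suffix_suffix.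
    have h : size k + size s - size q < size k = false by lia.
    rewrite qe !suffixE drop_cat !size_cat size_string_inv h.
    by have -> : size k + size s - size q - size k = size s - size q by lia.
  have : suffix q (u ++ s) by exact: suffix_catr.
  have h : size k' + size r - size q < size k' = false by lia.
  rewrite use !suffixE drop_cat size_cat size_string_inv h.
  by have -> : size k' + size r - size q - size k' = size r - size q by lia.
Qed.

Lemma isolated_inv (x0 : letter X) p u : isolated x0 p u -> isolated x0 p (string_inv u).
Proof.
have ag k : k + p < size u ->
    agrees x0 p (string_inv u) k = agrees x0 p u (size u - p.+1 - k).
  move=> kp; rewrite /agrees /string_inv !nth_rev ?size_map; try lia.
  rewrite !(nth_map x0); try lia.
  by rewrite (inj_eq (@flip_inj X)) eq_sym; congr (nth _ _ _ == nth _ _ _); lia.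
case=> u2 u0 uE ui; have {}u2 : p.+2 <= size u := u2.
split; rewrite ?size_string_inv //.
- by rewrite ag ?subn0 //; lia.
- by rewrite ag ?subnn //; lia.
- move=> i ib; have {}ib : 0 < i < size u - p.+1 := ib.
  rewrite ag; last lia.
  by apply: ui; change (0 < size u - p.+1 - i < size u - p.+1); lia.
Qed.

(** Runs are much longer than the margins of the blocks that carry them, and
    they have distinct lengths, so that a run is recognized by its length and
    cannot sit astride two blocks; as [size (U j)] exceeds [j], a given string
    contains only finitely many of them.
    The letter [x0] is the default value for reading letters of a string. *)
Record blocks (x0 : letter X) (p W : nat) (U m : nat -> seq (letter X)) : Prop :=
  Blocks {
    block_isolated : forall j, isolated x0 p (U j);
    block_run : forall j, exists L R,
      [/\ m j = L ++ U j ++ R, size L <= W & size R <= W];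
    block_size : forall j, 2 * W + 2 * p + 2 + j < size (U j);
    block_inj : injective (fun j => size (U j));
    block_reduced : forall i j, reduced (m i ++ m j) }.

Lemma reduced_junction q s t : q != [::] -> reduced (q ++ q) ->
  reduced s -> suffix q s -> reduced t -> prefix q t -> reduced (s ++ t).
Proof.
move=> q0 rq rs /suffixP[s' es] rt /prefixP[t' et]; subst s t.
by rewrite -catA; apply: reduced_glue => //; apply: reduced_glue.
Qed.

(** The blocks are [z q^n z] with [n] growing so fast that the bounded margins
    do not blur the lengths of the runs.  They are conjugate to elements of the
    submonoid generated by [x] and [y]; an arbitrary submonoid [S] is used to
    say this, as either this submonoid or the image of a homomorphism will be
    substituted for it. *)
Lemma blocks_exist x y : ~ commute x y ->
  exists (t : F) (x0 : letter X) p W U m, blocks x0 p W U m /\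
    forall S : set F, submonoid_set S -> S (x ^ t)%g -> S (y ^ t)%g ->
    forall j, S (fclass (m j)).
Proof.
move=> nxy; have x1 : x <> 1%g.
  by move=> x1; apply: nxy; rewrite x1; exact/commute_sym/commute1.
have [t0 [q [q0 rq xq]]] := cyclic_reduction x1; set t := fclass t0 in xq.
have [N [z [zE rz qz zq]]] := positive_sandwich (y ^ t)%g q0 rq.
have nc : z ++ q != q ++ z.
  apply/eqP => /(congr1 (@fclass X)); rewrite !fclass_cat zE => e; apply: nxy.
  apply: (@conjg_inj _ t); rewrite !conjMg xq.
  set A := (fclass q ^+ N)%g in e; set Q := fclass q in e *.
  have cN : (Q * A = A * Q)%g by rewrite /A -expgS expgSr.
  apply: (@mulgI _ A); apply: (@mulIg _ A).
  have -> : (A * (Q * y ^ t) * A = Q * (A * y ^ t * A))%g by rewrite !mulgA cN.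
  by rewrite -e -!mulgA cN.
have z0 : z != [::].
  by apply: contraNneq q0 => z0; move: qz; rewrite z0 prefixs0.
have p0 : 0 < size q by case: (q) q0.
(* The run of z q^n z has between n * size q and n * size q + 2 * size z
   letters: the slope keeps these ranges disjoint, and the constant term makes
   all runs long compared to the margins. *)
pose n j := (2 * size z + 1) * j + (2 * size z + 5).
have x0 : letter X by case: (q) q0.
pose m j := z ++ spow q (n j) ++ z.
have /choice[U UP] : forall j, exists u : seq (letter X),
    exists L R : seq (letter X), [/\ m j = L ++ u ++ R,
    isolated x0 (size q) u, size L <= size z & size R <= size z].
  move=> j; have [|L [u [R uP]]] := @isolated_around _ x0 q z (n j) z0 q0 _ qz zq nc.
    by rewrite /n; lia.
  by exists u, L, R.
have Usize j : n j * size q <= size (U j) <= n j * size q + 2 * size z.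
  have [L [R [mE _ sL sR]]] := UP j; move: (congr1 size mE).
  have {}sL : size L <= size z := sL; have {}sR : size R <= size z := sR.
  by rewrite /m !size_cat size_spow; move: (n j * size q) => k; lia.
have pos_m j : [/\ reduced (m j), prefix q (m j) & suffix q (m j)].
  have [k nk] : exists k, n j = k.+1 by exists (n j).-1; rewrite /n; lia.
  split; last 2 first.
  - exact: prefix_catl.
  - by rewrite /m catA; exact: suffix_catr.
  have qk : prefix q (spow q (n j)) by rewrite nk spowS prefix_prefix.
  have kq : suffix q (spow q (n j)) by rewrite nk spowSr suffix_suffix.
  have rk := reduced_spow (n j) q0 rq.
  have r2 : reduced (spow q (n j) ++ z) by exact: reduced_junction kq rz qz.
  apply: (reduced_junction q0 rq) => //; exact: prefix_catl.
exists t, x0, (size q), (size z), U, m; split.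
  split.
  - by move=> j; have [L [R []]] := UP j.
  - by move=> j; have [L [R [mE _ sL sR]]] := UP j; exists L, R.
  - by move=> j; have := Usize j; rewrite /n; nia.
  - have lt i j : i < j -> size (U i) < size (U j).
      move=> ij; have := Usize i; have := Usize j.
      have : n i * size q + (2 * size z + 1) * size q <= n j * size q.
        by rewrite -mulnDl leq_mul2r /n; apply/orP; right; nia.
      have : 2 * size z + 1 <= (2 * size z + 1) * size q by rewrite leq_pmulr.
      lia.
    move=> i j e; case: (ltngtP i j) => // /lt; lia.
  - move=> i j; have [ri _ si] := pos_m i; have [rj pj _] := pos_m j.
    exact: (reduced_junction q0 rq).
move=> S [S1 SM] Sx Sy j; have Sq k : S (fclass q ^+ k)%g.
  by elim: k => // k IH; rewrite expgS; apply: SM => //; rewrite -xq.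
rewrite /m !fclass_cat fclass_spow; have Sz : S (fclass z).
  by rewrite zE; apply: (SM _ _ (SM _ _ _ _)).
by apply: (SM _ _ _ (SM _ _ _ _)).
Qed.

End FreeGroup.

(** * Counting patterns with sign *)

Definition exponent (s : seq (letter nat)) (n : nat -> int) : int :=
  (\sum_(l <- s) if l.2 then - n l.1 else n l.1)%R.

(** Substitute [x ^ (n i)] for the variable of index [i]: powers of [x] commute,
    so only the exponents matter. *)
Lemma exponent1_surjective s n : exponent s n = 1%R ->
  forall (G : groupType) (x : G), exists g, string_eval g s = x.
Proof.
move=> sn G x.
(* The integer n i is written as a i - b i. *)
pose a i : nat := if n i is Posz k then k else 0.
pose b i : nat := if n i is Negz k then k.+1 else 0.
have nab i : n i = ((a i)%:Z - (b i)%:Z)%R by rewrite /a /b; case: (n i) => k; lia.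
pose P k l := (x ^+ k * x ^- l)%g.
have PM k l k' l' : (P k l * P k' l' = P (k + k') (l + l'))%g.
  rewrite /P (addnC l) !expgnDr invgM !mulgA; congr mulg; rewrite -!mulgA; congr mulg.
  exact/commute_sym/commuteV/commuteX2/commute_refl.
have PV k l : ((P k l)^-1 = P l k)%g by rewrite /P invgM invgK.
pose g i := P (a i) (b i).
have [c [d [e sx]]] : exists c d, exponent s n = (c%:Z - d%:Z)%R /\
    string_eval g s = P c d.
  elim: s {sn} => [|[i e] s [c [d [ec sx]]]].
    by exists 0, 0; rewrite /exponent /string_eval !big_nil /P mulgV.
  rewrite /exponent /string_eval !big_cons.
  rewrite -/(exponent s n) -/(string_eval g s) ec sx.
  case: e; rewrite /letter_eval /= nab /g.
    by exists (b i + c), (a i + d); split; [lia|rewrite PV PM].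
  by exists (a i + c), (b i + d); split; [lia|rewrite PM].
exists g; rewrite sx; have -> : c = d.+1 by lia.
by rewrite /P expgS mulgK.
Qed.

Section Counting.
Variables (X : choiceType) (x0 : letter X) (p W : nat).
Variables (U m : nat -> seq (letter X)).
Hypothesis bl : blocks x0 p W U m.
Local Notation F := (free_group X).
Implicit Types (x y : F) (s t : seq (letter X)).

Lemma run_inj : injective U.
Proof. by move=> i j e; apply: (block_inj bl); rewrite /= e. Qed.

Lemma run_big j : 2 * W + 2 * p + 2 + j < size (U j).
Proof. exact: block_size bl j. Qed.

Lemma run_gt0 j : 0 < size (U j).
Proof. by have := run_big j; lia. Qed.

Lemma few_long s : few (size s) (fun j => infix (U j) s).
Proof.
apply: (few_sub (few_lt (size s))) => j /size_infix; have := run_big j => h1 h2.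
by have {}h2 : size (U j) <= size s := h2; lia.
Qed.

(** A counting quasimorphism. *)
Definition excess j x : int :=
  ((occ (U j) (red x))%:Z - (occ (U j) (string_inv (red x)))%:Z)%R.

Definition hits j x : bool :=
  infix (U j) (red x) || infix (U j) (string_inv (red x)).

Lemma excessV j x : excess j (x^-1)%g = (- excess j x)%R.
Proof. by rewrite /excess redV string_invK opprB. Qed.

Lemma few_hits x : few (2 * size (red x)) (fun j => hits j x).
Proof.
have := few_or (few_long (red x)) (few_long (string_inv (red x))).
by rewrite size_string_inv addnn -mul2n => /few_sub; apply=> j /orP.
Qed.

Lemma excess_hits j x : excess j x <> 0%R -> hits j x.
Proof.
rewrite /hits -!(occ_gt0 _ (run_gt0 j)) /excess; case: (occ _ _) => [|a] //.
by case: (occ _ _).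
Qed.

Lemma few_straddles s t : few p.+1 (fun j => straddle (U j) s t).
Proof. exact: few_straddle run_inj (block_isolated bl). Qed.

(** The reduced forms of [x], [y] and [x * y] are glued from three pieces, two
    at a time.  This makes three cuts, and three more in the inverses; the
    counts are additive as soon as no pattern straddles one of the six. *)
Lemma excessM x y :
  few (6 * p.+1) (fun j => excess j (x * y)%g <> (excess j x + excess j y)%R).
Proof.
have [s [c [t [xe ye xye]]]] := red_mul x y.
pose V := @string_inv X.
have f := few_or (few_or (few_or (few_straddles s c) (few_straddles (V c) t))
  (few_or (few_straddles s t) (few_straddles (V c) (V s))))
  (few_or (few_straddles (V t) c) (few_straddles (V t) (V s))).
apply: few_sub (few_leq f (_ : _ <= 6 * p.+1)) _; first lia.
move=> j; have U0 := run_gt0 j; rewrite /excess xye xe ye !string_inv_cat string_invK.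
have [s1|s1] := boolP (straddle (U j) s c); first by left; left; left.
have [s2|s2] := boolP (straddle (U j) (V c) t); first by left; left; right.
have [s3|s3] := boolP (straddle (U j) s t); first by left; right; left.
have [s4|s4] := boolP (straddle (U j) (V c) (V s)); first by left; right; right.
have [s5|s5] := boolP (straddle (U j) (V t) c); first by right; left.
have [s6|s6] := boolP (straddle (U j) (V t) (V s)); first by right; right.
by rewrite !occ_cat // => ne; exfalso; apply: ne; lia.
Qed.

Lemma hitsM x y :
  few (2 * p.+1) (fun j => hits j (x * y)%g /\ ~ (hits j x \/ hits j y)).
Proof.
have [s [c [t [xe ye xye]]]] := red_mul x y.
pose V := @string_inv X.
have f := few_or (few_straddles s t) (few_straddles (V t) (V s)).
apply: few_sub (few_leq f (_ : _ <= 2 * p.+1)) _; first lia.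
move=> j [] /= mxy nm.
have [s1|s1] := boolP (straddle (U j) s t); first by left.
have [s2|s2] := boolP (straddle (U j) (V t) (V s)); first by right.
exfalso; apply: nm; move: mxy; have U0 := run_gt0 j.
have sum u v : ~~ straddle (U j) u v -> infix (U j) (u ++ v) ->
    infix (U j) u \/ infix (U j) v.
  move=> nst; rewrite -!occ_gt0 // occ_cat // addn_gt0 => /orP[]; by [left|right].
rewrite /hits xye xe ye !string_inv_cat string_invK => /orP[/(sum _ _ s1)|/(sum _ _ s2)] [h|h].
- by left; rewrite infix_catr.
- by right; rewrite infix_catl.
- by right; apply/orP; right; rewrite infix_catr.
- by left; apply/orP; right; rewrite infix_catl.
Qed.

Lemma excess_string_eval (g : nat -> F) (w : seq (letter nat)) :
  few (size w * (6 * p.+1))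
    (fun j => excess j (string_eval g w) <> exponent w (fun i => excess j (g i))).
Proof.
elim: w => [|l w IH].
  split=> s us sP; rewrite leqn0 size_eq0; case: s us sP => // j s _ /(_ j).
  rewrite inE eqxx => /(_ isT) []; rewrite /string_eval /exponent !big_nil.
  by rewrite /excess red1.
rewrite [size _]/= mulSn.
apply: (few_sub (few_or (excessM (letter_eval g l) (string_eval g w)) IH)) => j.
rewrite /string_eval /exponent !big_cons -/(string_eval g w).
rewrite -/(exponent w _) => ne.
have [e1|] := pselect (excess j (letter_eval g l * string_eval g w)%g =
  (excess j (letter_eval g l) + excess j (string_eval g w))%R); last by left.
right=> e2; apply: ne; rewrite e1 e2; congr (_ + _)%R.
by rewrite /letter_eval; case: l.2; rewrite ?excessV.
Qed.

Definition block_product N := flatten [seq m j | j <- iota 0 N].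

Lemma block_neq0 j : m j != [::].
Proof.
have [L [R [mE _ _]]] := block_run bl j; apply/eqP => /(congr1 (@size (letter X))).
by rewrite mE !size_cat /=; have := run_gt0 j; lia.
Qed.

Lemma reduced_block j : reduced (m j).
Proof. exact: reduced_catl (block_reduced bl j j). Qed.

Lemma reduced_flatten_blocks js : reduced (flatten [seq m j | j <- js]).
Proof.
elim: js => [|i [|k js] IH] //=; first by rewrite cats0 reduced_block.
exact: reduced_glue (block_neq0 k) (block_reduced bl i k) IH.
Qed.

(** The lengths force [i = j], and no nonempty reduced string is its own
    inverse. *)
Lemma run_inv_neq i j : U i <> string_inv (U j).
Proof.
move=> e; have ij : i = j.
  by apply: (block_inj bl) => /=; rewrite e size_string_inv.
have rj : reduced (U j).
  have [L [R [mE _ _]]] := block_run bl j.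
  by apply: reduced_infix (reduced_block j); rewrite mE infix_infix.
by have := run_gt0 j; rewrite (reduced_inv_eq rj) // -e ij.
Qed.

Lemma occ_block i j : occ (U j) (m i) = (i == j).
Proof.
have [L [R [mE sL sR]]] := block_run bl i.
have only k : occurs (U j) k (m i) -> k = size L /\ U j = U i.
  rewrite mE; apply: isolated_only (block_isolated bl j) (block_isolated bl i) sL sR _.
  by change (W + p.+1 < size (U j)); have := run_big j; lia.
case: eqP => [ij|ij].
  apply: (@occ_unique _ _ (size L)); first exact: run_gt0.
    by rewrite mE -ij; exact: occurs_mid.
  by move=> k /only[].
apply/eqP; rewrite -leqn0 leqNgt occ_gt0 ?run_gt0 //; apply/negP.
by move=> /infix_occurs[k _ /only[_ /run_inj]] ji; exact: ij.
Qed.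

Lemma occ_block_inv i j : occ (U j) (string_inv (m i)) = 0.
Proof.
have [L [R [mE sL sR]]] := block_run bl i.
apply/eqP; rewrite -leqn0 leqNgt occ_gt0 ?run_gt0 //; apply/negP.
move=> /infix_occurs[k _]; rewrite mE !string_inv_cat -catA => ou.
have [_ e] : k = size (string_inv R) /\ U j = string_inv (U i).
  apply: isolated_only (block_isolated bl j) (isolated_inv (block_isolated bl i)) _ _ _ ou.
  - by rewrite size_string_inv; exact: sR.
  - by rewrite size_string_inv; exact: sL.
  - by change (W + p.+1 < size (U j)); have := run_big j; lia.
exact: run_inv_neq e.
Qed.

Lemma rframed_inv s : lframed x0 p W s -> rframed x0 p W (string_inv s).
Proof.
move=> [L [v [R [-> vi sL]]]]; exists (string_inv R), (string_inv v), (string_inv L).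
by rewrite !string_inv_cat -catA size_string_inv; split=> //; exact: isolated_inv.
Qed.

Lemma lframed_inv s : rframed x0 p W s -> lframed x0 p W (string_inv s).
Proof.
move=> [L [v [R [-> vi sR]]]]; exists (string_inv R), (string_inv v), (string_inv L).
by rewrite !string_inv_cat -catA size_string_inv; split=> //; exact: isolated_inv.
Qed.

Lemma block_lframed i : lframed x0 p W (m i).
Proof.
have [L [R [mE sL sR]]] := block_run bl i.
by exists L, (U i), R; split=> //; exact: block_isolated bl i.
Qed.

Lemma block_rframed i : rframed x0 p W (m i).
Proof.
have [L [R [mE sL sR]]] := block_run bl i.
by exists L, (U i), R; split=> //; exact: block_isolated bl i.
Qed.

(** Each block frames its run, so patterns do not straddle the junctions of
    blocks, and the numbers of occurrences add up. *)
Lemma occ_flatten_blocks js j :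
  occ (U j) (flatten [seq m i | i <- js]) = count_mem j js /\
  occ (U j) (string_inv (flatten [seq m i | i <- js])) = 0.
Proof.
elim: js => [|i [|k js] [IH1 IH2]]; first by rewrite /= /occ.
  by rewrite /= cats0 occ_block occ_block_inv addn0.
have lf : lframed x0 p W (flatten [seq m i | i <- k :: js]).
  by apply: lframed_cat; exact: block_lframed.
have bigU : 2 * W + 2 * p + 2 < size (U j) by have := run_big j; lia.
have U0 := run_gt0 j.
split; rewrite -cat1s map_cat flatten_cat /= cats0.
  rewrite occ_cat // ?occ_block ?IH1 //.
  exact: straddle_framed (block_isolated bl j) (block_rframed i) lf bigU.
rewrite string_inv_cat occ_cat // ?occ_block_inv ?IH2 //.
apply: straddle_framed (block_isolated bl j) _ _ bigU.
  exact: rframed_inv.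
by apply: lframed_inv; exact: block_rframed.
Qed.

Lemma red_block_product N : red (fclass (block_product N)) = block_product N.
Proof. exact/fclassK/reduced_flatten_blocks. Qed.

Lemma excess_block_product j N : j < N ->
  excess j (fclass (block_product N)) = 1%R.
Proof.
move=> jN; rewrite /excess red_block_product.
have [-> ->] := occ_flatten_blocks (iota 0 N) j.
by rewrite count_uniq_mem ?iota_uniq // mem_iota add0n /= jN.
Qed.

(** With more than [C] blocks in the product, some index [j] escapes all
    exceptional sets; at this index the excess of the product is [1], and equal
    to the weighted exponent sum. *)
Theorem no_sandwich (w : seq (letter nat)) (a b : F) :
  (forall n, exponent w n <> 1%R) ->
  ~ (forall N, exists g, string_eval g w = (a * fclass (block_product N) * b)%g).
Proof.
move=> w1 sandwich.
pose C := size w * (6 * p.+1) + (6 * p.+1 + 6 * p.+1) +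
  (2 * size (red a) + 2 * size (red b)).
have [g gE] := sandwich C.+1; set P := fclass _ in gE.
have f := few_or (few_or (excess_string_eval g w) (few_or (excessM (a * P)%g b) (excessM a P)))
  (few_or (few_hits a) (few_hits b)).
have := few_size f (iota_uniq 0 C.+1); rewrite size_iota ltnn.
move=> abs; suff: false by []; apply: abs => j; rewrite mem_iota add0n => /andP[_ jC].
have eP : excess j P = 1%R by exact: excess_block_product.
have [e1|] := pselect (excess j (string_eval g w) = exponent w (fun i => excess j (g i)));
  last by left; left.
have [e2|] := pselect (excess j (a * P * b)%g = (excess j (a * P)%g + excess j b)%R);
  last by left; right; left.
have [e3|] := pselect (excess j (a * P)%g = (excess j a + excess j P)%R);
  last by left; right; right.
have [e4|] := pselect (excess j a = 0%R); last by move=> /excess_hits; right; left.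
have [e5|] := pselect (excess j b = 0%R); last by move=> /excess_hits; right; right.
case: (w1 (fun i => excess j (g i))).
by rewrite -e1 gE e2 e3 e4 e5 eP add0r addr0.
Qed.

End Counting.

(** * Values of words that keep many patterns *)

Section Values.
Variables (X : choiceType) (x0 : letter X) (p W : nat).
Variables (U m : nat -> seq (letter X)).
Hypothesis bl : blocks x0 p W U m.
Local Notation F := (free_group X).
Implicit Types (x y : F) (s t : seq (letter X)).

Definition signed (f : nat -> seq (letter X)) (l : letter nat) :=
  if l.2 then string_inv (f l.1) else f l.1.

Lemma signed_flip f l : signed f (flip l) = string_inv (signed f l).
Proof. by rewrite /signed /flip; case: l => i [] //=; rewrite string_invK. Qed.

Lemma signed_run l : exists L R : seq (letter X), [/\ signed m l = L ++ signed U l ++ R,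
  size L <= W & size R <= W].
Proof.
have [L [R [mE sL sR]]] := block_run bl l.1; case: l mE => i [] /= mE.
  exists (string_inv R), (string_inv L).
  by rewrite /signed /= mE !string_inv_cat -catA !size_string_inv.
by exists L, R.
Qed.

Lemma signed_isolated l : isolated x0 p (signed U l).
Proof.
by rewrite /signed; case: l.2; first apply: isolated_inv; exact: block_isolated bl _.
Qed.

Lemma size_signed l : size (signed U l) = size (U l.1).
Proof. by rewrite /signed; case: l.2; rewrite ?size_string_inv. Qed.

Lemma signed_run_inj : injective (signed U).
Proof.
move=> [i e] [j f] eU; have ij : i = j.
  by apply: (block_inj bl) => /=; rewrite -(size_signed (i, e)) eU size_signed.
move: eU; rewrite -ij; case: e f => [] [] //; rewrite /signed /= => eU.
  by case: (run_inv_neq bl (i := i) (j := i)).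
by case: (run_inv_neq bl (i := i) (j := i)).
Qed.

(** Two blocks or inverses of blocks at the end of the same text have runs that
    overlap, hence coincide. *)
Lemma signed_suffix s l k : suffix (signed m l) s -> suffix (signed m k) s -> l = k.
Proof.
have main l' k' : suffix (signed m l') s -> suffix (signed m k') s ->
    forall L R L' R' : seq (letter X), signed m l' = L ++ signed U l' ++ R ->
    signed m k' = L' ++ signed U k' ++ R' -> size R <= W -> size R' <= W ->
    size R' + size (U k'.1) <= size R + size (U l'.1) -> l' = k'.
  move=> sl sk L R L' R' eL eL' sR sR' le.
  have [t te] : exists t : seq (letter X), s = t ++ signed m l' by exact/suffixP.
  have [t' te'] : exists t : seq (letter X), s = t ++ signed m k' by exact/suffixP.
  have ol := occurs_mid (t ++ L) (signed U l') R.
  have ok := occurs_mid (t' ++ L') (signed U k') R'.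
  rewrite -catA -eL -te in ol; rewrite -catA -eL' -te' in ok.
  have s1 : size s = size t + (size L + (size (U l'.1) + size R)).
    by rewrite te eL !size_cat size_signed.
  have s2 : size s = size t' + (size L' + (size (U k'.1) + size R')).
    by rewrite te' eL' !size_cat size_signed.
  have bl1 := run_big bl l'.1; have bl2 := run_big bl k'.1.
  apply: signed_run_inj.
  have [|//] := isolated_collide (signed_isolated l') (signed_isolated k') ol ok.
  change (is_true (size (t ++ L) <= size (t' ++ L') <
    size (t ++ L) + (size (signed U l') - p.+1))).
  by rewrite !size_cat size_signed; lia.
move=> sl sk; have [L [R [eL _ sR]]] := signed_run l.
have [L' [R' [eL' _ sR']]] := signed_run k.
case: (leqP (size R' + size (U k.1)) (size R + size (U l.1))) => [le|/ltnW le].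
  exact: main sl sk _ _ _ _ eL eL' sR sR' le.
exact/esym/(main _ _ sk sl _ _ _ _ eL' eL sR' sR le).
Qed.

Definition padded N j := m j ++ block_product m N ++ m j.

Lemma signed_padded N l : signed (padded N) l =
  signed m l ++ signed (fun=> block_product m N) l ++ signed m l.
Proof.
by rewrite /signed /padded; case: l.2; rewrite // !string_inv_cat -catA.
Qed.

Lemma reduced_signed_padded N l : reduced (signed (padded N) l).
Proof.
have r : reduced (padded N l.1).
  have := reduced_flatten_blocks bl (l.1 :: iota 0 N ++ [:: l.1]).
  by rewrite /= map_cat flatten_cat /= cats0.
by rewrite /signed; case: l.2; rewrite ?reduced_inv.
Qed.

Lemma letter_eval_fclass (f : nat -> seq (letter X)) l :
  letter_eval (fun i => fclass (f i)) l = fclass (signed f l).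
Proof. by rewrite /letter_eval /signed; case: l.2; rewrite ?fclass_inv. Qed.

(** When the image of a letter [l] is appended, the text ends with the block of
    the previous letter [k], up to sign.  The cancellation stays within the first
    block of the new image: otherwise the text would also end with the inverse
    of this block, which forces [k = flip l]. *)
Lemma suffix_padded N (w : seq (letter nat)) l : reduced (rcons w l) ->
  suffix (signed (fun=> block_product m N) l ++ signed m l)
    (red (string_eval (fun i => fclass (padded N i)) (rcons w l))).
Proof.
elim/last_ind: w l => [|w k IH] l rw.
  rewrite /string_eval big_seq1 letter_eval_fclass fclassK ?reduced_signed_padded //.
  by rewrite signed_padded suffix_suffix.
have rwk : reduced (rcons w k).
  by apply: (@reduced_catl _ _ [:: l]); rewrite cats1.
have kl : k != flip l.
  move: rw; rewrite -cats1 reduced_rcons_cons => /and3P[_ _].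
  by apply: contraNneq => ->; rewrite flipK.
have := IH k rwk; set x := string_eval _ (rcons w k) => sx.
have xk : suffix (signed m k) (red x) by exact: catl_suffix sx.
have -> : string_eval (fun i => fclass (padded N i)) (rcons (rcons w k) l) =
    (x * fclass (signed (padded N) l))%g.
  by rewrite /string_eval -cats1 big_cat /= big_seq1 letter_eval_fclass.
have [s [c [t [xe ye ->]]]] := red_mul x (fclass (signed (padded N) l)).
rewrite fclassK ?reduced_signed_padded // signed_padded in ye.
have cl : size c < size (signed m l).
  rewrite ltnNge; apply/negP => lc; case/eqP: kl.
  apply: signed_suffix xk _; rewrite signed_flip xe; apply: suffix_catr.
  have : prefix (signed m l) (string_inv c).
    have lc' : size (signed m l) <= size (string_inv c) by rewrite size_string_inv.
    by rewrite prefixE -(takel_cat t lc') -ye take_size_cat.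
  by move=> /prefixP[r e]; rewrite -(string_invK c) e string_inv_cat suffix_suffix.
apply: suffix_catr; rewrite -[t](drop_size_cat (s1 := string_inv c) _ (erefl _)) -ye.
rewrite drop_cat size_string_inv cl; exact: suffix_suffix.
Qed.

Theorem many_runs_in_value N (w : seq (letter nat)) j :
  reduced w -> w != [::] -> j < N ->
  hits U j (string_eval (fun i => fclass (padded N i)) w).
Proof.
case/lastP: w => // w l rw _ jN.
have : infix (signed (fun=> block_product m N) l)
    (red (string_eval (fun i => fclass (padded N i)) (rcons w l))).
  apply: infix_suffix_trans (suffix_padded N rw); exact: prefix_infix.
have Uj : infix (U j) (block_product m N).
  rewrite -occ_gt0 ?(run_gt0 bl) // (occ_flatten_blocks bl (iota 0 N) j).1.
  by rewrite -has_count has_pred1 mem_iota.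
rewrite /hits /signed; case: l.2 => sx; apply/orP; [right|left].
  apply: (infix_trans Uj); rewrite -(string_invK (block_product m N)).
  exact: infix_inv.
exact: infix_trans Uj sx.
Qed.

End Values.

(** * Patterns in elements of commuting sets *)

Section Commuting.
Variable X : choiceType.
Local Notation F := (free_group X).
Implicit Types (x y : F) (q s t g : seq (letter X)).

Lemma red_mul_size x y :
  size (red (x * y)%g) = size (red x) + size (red y) -> reduced (red x ++ red y).
Proof.
have [s [c [t [-> -> e]]]] := red_mul x y; rewrite e !size_cat size_string_inv => h.
have c0 : c = [::] by apply: size0nil; lia.
by move: (red_reduced (x * y)%g); rewrite e c0 /= cats0.
Qed.

(** If [g ++ q] or [q ++ g] is not reduced, then neither is reduced, as [g * q]
    and [q * g] have the same length.  Then the inverse of [g] starts with the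
    first letter of [q] and ends with its last one, and as [q] is cyclically
    reduced, no letter cancels in its products with [q]. *)
Lemma commute_cyclically_reduced q g : q != [::] -> reduced (q ++ q) -> reduced g ->
  commute (fclass g) (fclass q) ->
  g ++ q = q ++ g \/ string_inv g ++ q = q ++ string_inv g.
Proof.
move=> q0 rqq rg cgq; have rq := reduced_catl rqq.
have nocancel s : reduced s -> commute (fclass s) (fclass q) ->
    reduced (s ++ q) -> s ++ q = q ++ s.
  move=> rs csq rsq.
  have e : fclass (s ++ q) = fclass (q ++ s) by rewrite !fclass_cat.
  have : reduced (q ++ s).
    have := @red_mul_size (fclass q) (fclass s).
    rewrite (fclassK rq) (fclassK rs) -fclass_cat -e (fclassK rsq); apply.
    by rewrite size_cat addnC.
  by move=> rqs; rewrite -[LHS](fclassK rsq) e fclassK.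
have [r1|nr1] := boolP (reduced (g ++ q)); first by left; exact: nocancel.
have [r2|nr2] := boolP (reduced (q ++ g)).
  case/negP: nr1; have := @red_mul_size (fclass g) (fclass q).
  rewrite (fclassK rg) (fclassK rq) cgq -fclass_cat (fclassK r2); apply.
  by rewrite size_cat addnC.
right; apply: nocancel; rewrite ?reduced_inv //.
  by rewrite fclass_inv; apply/commute_sym/commuteV/commute_sym.
case: g rg cgq nr1 nr2 => [|a g] rg cgq nr1 nr2; first by rewrite rq in nr1.
rewrite string_inv_cons; case: q q0 rqq rq cgq nr1 nr2 => // c q _ rqq rq _ nr1 nr2.
rewrite reduced_rcons_cons -string_inv_cons reduced_inv rg rq /= flipK.
have e := lastI c q; set d := last c q in e; set q' := belast c q in e.
move: rqq nr2; rewrite [X in reduced (X ++ c :: q)]e [X in reduced (X ++ a :: g)]e.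
rewrite !reduced_rcons_cons -e rq rg /=.
by move=> cd; rewrite negbK => /eqP ->.
Qed.

Lemma commute_prefix q g : q != [::] -> reduced (q ++ q) -> reduced g ->
  commute (fclass g) (fclass q) ->
  exists n, prefix g (spow q n) \/ prefix (string_inv g) (spow q n).
Proof.
move=> q0 rq rg c.
have [e|e] := commute_cyclically_reduced q0 rq rg c.
  by exists (size g); left; exact: commuting_strings_prefix.
exists (size (string_inv g)); right; exact: commuting_strings_prefix.
Qed.

Lemma periodic_inv (x0 : letter X) d s : periodic x0 d s -> periodic x0 d (string_inv s).
Proof.
move=> ps i; rewrite size_string_inv => il; rewrite /agrees /string_inv.
rewrite !nth_rev ?size_map; try lia; rewrite !(nth_map x0); try lia.
rewrite (inj_eq (@flip_inj X)) eq_sym; have := ps (size s - (i + d).+1).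
rewrite /agrees (_ : size s - (i + d).+1 + d = size s - i.+1); last lia.
by apply; change (size s - i.+1 < size s); lia.
Qed.

End Commuting.

(** The sets that a rational expression yields when all the submonoids that it
    generates are commutative. *)
Inductive bounded (M : monoidType) : set M -> Prop :=
| bounded_commuting A :
    (forall x y, A x -> A y -> commute x y) -> bounded A
| bounded_union A B : bounded A -> bounded B -> bounded (A `|` B)%classic
| bounded_product A B : bounded A -> bounded B -> bounded (set_product A B).

Section BoundedRuns.
Variables (X : choiceType) (x0 : letter X) (p W : nat).
Variables (U m : nat -> seq (letter X)).
Hypothesis bl : blocks x0 p W U m.
Local Notation F := (free_group X).
Implicit Types (x y : F).

Lemma few_hitsM a b x y : few a (fun j => hits U j x) -> few b (fun j => hits U j y) ->
  few (2 * p.+1 + (a + b)) (fun j => hits U j (x * y)%g).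
Proof.
move=> fx fy; apply: (few_sub (few_or (hitsM bl x y) (few_or fx fy))) => j h.
by have [h'|] := pselect (hits U j x \/ hits U j y); [right|left].
Qed.

(** Let [c <> 1] be an element of [A], conjugate to a cyclically reduced [q].
    The same conjugation turns all elements of [A] into elements that commute
    with [q], whose reduced forms have period [size q] and so do not contain
    long runs of another period. *)
Lemma few_hits_commuting (A : set F) :
  (forall x y, A x -> A y -> commute x y) ->
  exists C, forall x, A x -> few C (fun j => hits U j x).
Proof.
move=> cA; have [[c [Ac c1]]|triv] := pselect (exists c, A c /\ c <> 1%g); last first.
  exists 0 => x Ax; have -> : x = 1%g by apply: contrapT => x1; apply: triv; exists x.
  by have := few_hits bl 1%g; rewrite red1.
have [t [q [q0 rq tq]]] := cyclic_reduction c1; set T := fclass t in tq.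
exists (2 * p.+1 + (2 * size (red T) + (2 * p.+1 + (size q + 2 * size (red T^-1)%g)))).
move=> x Ax; have -> : x = (T * (x ^ T * T^-1))%g by rewrite mulgA conjgE mulKVg mulgK.
apply: few_hitsM (few_hits bl T) _; apply: few_hitsM (few_hits bl _).
have cq : commute (fclass (red (x ^ T)%g)) (fclass q).
  by rewrite redK -tq /commute -!conjMg cA.
have [n pre] := commute_prefix q0 rq (red_reduced _) cq.
have per : periodic x0 (size q) (red (x ^ T)%g).
  case: pre => /periodic_prefix; first by apply; exact: periodic_spow.
  by move=> /(_ x0 _ (@periodic_spow _ x0 q n)) /periodic_inv; rewrite string_invK.
have sq : 0 < size q by case: (q) q0.
apply: (few_sub (few_lt (size q))) => j hj; rewrite ltnNge; apply/negP => qj.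
have big : size q + p.+1 < size (U j) by have := run_big bl j; lia.
by case/orP: hj => h; apply: (isolated_periodic sq (block_isolated bl j) _ big h) => //;
  exact: periodic_inv.
Qed.

Lemma few_hits_bounded (A : set F) : bounded A ->
  exists C, forall x, A x -> few C (fun j => hits U j x).
Proof.
elim=> {A} [A|A B _ [C gen_a] _ [D gen_b]|A B _ [C gen_a] _ [D gen_b]].
- exact: few_hits_commuting.
- exists (C + D) => x [/gen_a|/gen_b] f; apply: few_leq f _; lia.
- exists (2 * p.+1 + (C + D)) => _ [x Ax [y By <-]]; exact: few_hitsM (gen_a x Ax) (gen_b y By).
Qed.

End BoundedRuns.

(** * Rational subsets and verbal sets *)

Section Rationality.
Local Open Scope classical_set_scope.

Lemma rational_image (M N : monoidType) (f : M -> N) (A : set M) :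
  f 1%g = 1%g -> {morph f : x y / (x * y)%g} -> rational A -> rational (f @` A).
Proof.
move=> f1 fM; elim=> {A} [A gen_a|A B _ IHA _ IHB|A B _ IHA _ IHB|A _ IHA].
- exact/rational_finite/finite_image.
- rewrite image_setU; exact: rational_union.
- have -> : f @` set_product A B = set_product (f @` A) (f @` B).
    apply/seteqP; split=> [_ [_ [x Ax [y By <-]] <-]|_ [_ [x Ax <-] [_ [y By <-] <-]]].
      by exists (f x); [exists x|exists (f y); [exists y|rewrite fM]].
    by exists (x * y)%g; [exists x => //; exists y|rewrite fM].
  exact: rational_product.
- have -> : f @` submonoid_gen A = submonoid_gen (f @` A).
    apply/seteqP; split=> [_ [x Ax <-]|].
      pose B := f @^-1` submonoid_gen (f @` A).
      apply: (Ax B); split; last first.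
        by move=> y Ay S [_ sA]; apply: sA; exists y.
      split; rewrite /B /preimage /=; first by rewrite f1 => S [[]].
      by move=> y z By Bz; rewrite fM => S SA; apply: SA.1.2; [exact: By|exact: Bz].
    apply: smallest_sub; last first.
      by move=> _ [y Ay <-]; exists y => // S [_]; apply.
    split; first by exists 1%g => // S [[]].
    move=> _ _ [x Ax <-] [y Ay <-]; exists (x * y)%g => //.
    by move=> S SA; apply: SA.1.2; [exact: Ax|exact: Ay].
  exact: rational_star.
Qed.

Lemma bounded_finite (M : monoidType) (A : set M) : finite_set A -> bounded A.
Proof.
move=> /finite_seqP[s ->]; elim: s => [|x s IH].
  by apply: bounded_commuting.
have -> : [set` x :: s] = [set x] `|` [set` s].
  apply/seteqP; split=> y /=; rewrite inE; first by move=> /orP[/eqP|]; [left|right].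
  by move=> [->|->]; rewrite ?eqxx ?orbT.
apply: bounded_union IH; apply: bounded_commuting => y z -> ->.
exact: commute_refl.
Qed.

(** The second case occurs as soon as one of the submonoids generated in a
    rational expression for [A] is not commutative, provided that the other
    factors of the products that it enters are not empty. *)
Lemma rational_dichotomy (M : monoidType) (A : set M) : rational A ->
  bounded A \/ exists a b x y, ~ commute x y /\
    forall z, submonoid_gen [set x; y] z -> A (a * z * b)%g.
Proof.
elim=> {A} [A gen_a|A B _ IHA _ IHB|A B _ IHA _ IHB|A _ IHA].
- by left; exact: bounded_finite.
- case: IHA => [bA|[a [b [x [y [nxy sub]]]]]]; last first.
    by right; exists a, b, x, y; split=> // z /sub; left.
  case: IHB => [bB|[a [b [x [y [nxy sub]]]]]]; last first.
    by right; exists a, b, x, y; split=> // z /sub; right.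
  by left; exact: bounded_union.
- have empty_bounded C : C = set0 -> bounded C.
    by move=> ->; apply: bounded_commuting.
  have [A0|/set0P[a0 Aa0]] := eqVneq A set0.
    by left; apply: empty_bounded; rewrite A0; apply/seteqP; split=> // z [x []].
  have [B0|/set0P[b0 Bb0]] := eqVneq B set0.
    by left; apply: empty_bounded; rewrite B0; apply/seteqP; split=> // z [x _ [y []]].
  case: IHA => [bA|[a [b [x [y [nxy sub]]]]]]; last first.
    right; exists a, (b * b0)%g, x, y; split=> // z /sub Az.
    by rewrite mulgA; exists (a * z * b)%g => //; exists b0.
  case: IHB => [bB|[a [b [x [y [nxy sub]]]]]]; last first.
    right; exists (a0 * a)%g, b, x, y; split=> // z /sub Bz.
    by rewrite -!mulgA (mulgA a); exists a0 => //; exists (a * z * b)%g.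
  by left; exact: bounded_product.
- have [cA|] := pselect (forall x y, submonoid_gen A x -> submonoid_gen A y -> commute x y).
    by left; exact: bounded_commuting.
  move=> /existsNP[x /existsNP[y /not_implyP[Ax /not_implyP[Ay nxy]]]].
  right; exists 1%g, 1%g, x, y; split=> // z xyz; rewrite mul1g mulg1.
  move=> S SA; apply: xyz; split; first exact: SA.1.
  by move=> _ [->|->]; [exact: Ax|exact: Ay].
Qed.

Lemma string_eval_morph (G K : groupType) (f : G -> K) (g : nat -> G) w :
  {morph f : x y / (x * y)%g} -> f (string_eval g w) = string_eval (f \o g) w.
Proof.
move=> fM; have f1 : f 1%g = 1%g.
  by apply: (@mulgI _ (f 1%g)); rewrite -fM !mulg1.
have fV x : f (x^-1)%g = (f x)^-1%g.
  by apply: (@mulgI _ (f x)); rewrite -fM !mulgV.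
elim: w => [|l w IH]; first by rewrite /string_eval !big_nil.
rewrite /string_eval !big_cons fM -!/(string_eval _ w) IH; congr mulg.
by rewrite /letter_eval; case: l.2; rewrite ?fV.
Qed.

Lemma submonoid_conj_preimage (G : groupType) (A : set G) (t : G) :
  submonoid_set A -> submonoid_set [set x | A (t * x * t^-1)%g].
Proof.
move=> [A1 AM]; split=> [|x y Ax Ay] /=; first by rewrite mulg1 mulgV.
have -> : (t * (x * y) * t^-1 = t * x * t^-1 * (t * y * t^-1))%g.
  by rewrite -!mulgA mulKg.
exact: AM.
Qed.

(** The case of a sandwich contradicts the existence of a group where not all
    elements are values of [w]; the bounded case contradicts the existence of a
    group where [w] has a nontrivial value. *)
Theorem verbal_set_not_rational (H : groupType) (X : choiceType)
    (f : H -> free_group X) (w : word) (h k : H) :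
  {morph f : x y / (x * y)%g} -> ~ commute (f h) (f k) ->
  proper_word w -> ~ rational (verbal_set w H).
Proof.
move=> fM nhk [[G1 nontriv] [G2 nontotal]] ratw.
have f1 : f 1%g = 1%g by apply: (@mulgI _ (f 1%g)); rewrite -fM !mulg1.
have ratF := rational_image f1 fM ratw.
have conjgTK (t x : free_group X) : (t * x ^ t * t^-1)%g = x.
  by rewrite conjgE mulKVg mulgK.
case: (rational_dichotomy ratF) => [bd|[a [b [x [y [nxy sub]]]]]].
  have [t [x0 [p [W [U [m [bl mS]]]]]]] := blocks_exist nhk.
  have [C fC] := few_hits_bounded bl bd.
  pose r := red w.
  have r0 : r != [::].
    apply/eqP => r0; apply: nontriv; have w1 : w = 1%g by rewrite -(redK w) -/r r0.
    have w1g (g : nat -> G1) : word_value w g = 1%g.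
      rewrite w1 /word_value (_ : 1%g = fclass [::]) //.
      by rewrite pres_lift_class // /string_eval big_nil.
    by apply/seteqP; split=> [_ [g _ <-]|_ ->]; [exact: w1g|exists (fun=> 1%g)].
  have wv (K : groupType) (g : nat -> K) : word_value w g = string_eval g r.
    by rewrite -{1}(redK w) /word_value pres_lift_class.
  have fS : submonoid_set (range f).
    split; first by exists 1%g.
    by move=> _ _ [u _ <-] [v _ <-]; exists (u * v)%g.
  have Sm j : range f (t * fclass (m j) * t^-1)%g.
    apply: (mS _ (submonoid_conj_preimage t fS)) => /=; rewrite conjgTK.
      by exists h.
    by exists k.
  have SM s s' : range f (t * fclass s * t^-1)%g -> range f (t * fclass s' * t^-1)%g ->
      range f (t * fclass (s ++ s') * t^-1)%g.
    rewrite fclass_cat; exact: (submonoid_conj_preimage t fS).2.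
  (* The cost of undoing the conjugation by t. *)
  pose C' := 2 * p.+1 +
    (2 * size (red t^-1%g) + (2 * p.+1 + (C + 2 * size (red t)))).
  have /choice[g gE] : forall i, exists u,
      f u = (t * fclass (padded m C'.+1 i) * t^-1)%g.
    move=> i; suff [u _ <-] : range f (t * fclass (padded m C'.+1 i) * t^-1)%g.
      by exists u.
    apply: (SM _ _ _ (SM _ _ _ _)) => //; rewrite /block_product.
    elim: (iota _ _) => [|j js IH]; last exact: (SM _ _ _ IH).
    by rewrite /= mulg1 mulgV; exact: fS.1.
  pose y := string_eval (fun i => fclass (padded m C'.+1 i)) r.
  have fy : f (word_value w g) = (t * y * t^-1)%g.
    rewrite wv string_eval_morph //.
    rewrite (string_eval_morph (f := fun x => t * x * t^-1)%g); last first.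
      by move=> u v; rewrite -!mulgA mulKg.
    by congr string_eval; apply/funext => i /=; rewrite gE.
  have few_y : few C' (fun j => hits U j y).
    have -> : y = (t^-1 * ((t * y * t^-1) * t))%g by rewrite mulgVK mulKg.
    apply: (few_hitsM bl (few_hits bl _)); apply: (few_hitsM bl _ (few_hits bl _)).
    by rewrite -fy; apply: fC; exists (word_value w g) => //; exists g.
  have := few_size few_y (iota_uniq 0 C'.+1); rewrite size_iota ltnn => abs.
  suff: false by []; apply: abs => j; rewrite mem_iota => /andP[_ jC].
  by apply: (many_runs_in_value bl _ r0); [exact: red_reduced|move: jC; rewrite add0n].
have [t [x0 [p [W [U [m [bl mS]]]]]]] := blocks_exist nxy.
apply: (no_sandwich bl (w := pres_repr w) (a := (a * t)%g) (b := (t^-1 * b)%g)).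
  move=> n /exponent1_surjective univ; apply: nontotal.
  by apply/seteqP; split=> // z _; have [g <-] := univ G2 z; exists g.
move=> N; have subm : submonoid_set (submonoid_gen [set x; y]).
  split=> [S [[]] //|u v uS vS S SA]; apply: SA.1.2; [exact: uS|exact: vS].
have SN : submonoid_gen [set x; y] (t * fclass (block_product m N) * t^-1)%g.
  rewrite /block_product; elim: (iota 0 N) => [|j js IH].
    by rewrite /= mulg1 mulgV; exact: subm.1.
  rewrite /= fclass_cat; apply: (submonoid_conj_preimage t subm).2 => //.
  apply: mS; first exact: submonoid_conj_preimage.
    by rewrite /= conjgTK => S [_]; apply; left.
  by rewrite /= conjgTK => S [_]; apply; right.
have [_ [g _ <-] e] := sub _ SN.
by exists (f \o g); rewrite -string_eval_morph // [LHS]e !mulgA.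
Qed.

End Rationality.

(** * Pure braid groups *)

Section Braids.
Local Open Scope group_scope.

Local Notation F2 := (free_group bool).
Definition gen_a : F2 := fclass [:: pos true].
Definition gen_b : F2 := fclass [:: pos false].

Lemma gen_a_gen_b_neq : ~ commute gen_a gen_b.
Proof.
rewrite /commute /gen_a /gen_b -!fclass_cat => /(congr1 (@red _)).
by rewrite !fclassK.
Qed.

Definition swap_pos (i k : nat) : nat :=
  if k == i then i.+1 else if k == i.+1 then i else k.

(** The triple gives the positions of three strands.  A pure braid on three
    strands is, modulo the centre, an element of the free group on the squares
    [gen_a] and [gen_b] of the two generators of the braid group.  Comparing a
    braid step by step with the positive permutation braid of the arrangement
    of its strands, a crossing contributes nothing when it creates an
    inversion, and a conjugate of the square of a generator when it removes
    one.  The square for the two outer strands is a product of the inverses of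
    the two other ones, as the full twist becomes trivial; the order of the
    factors depends on the side on which the middle strand is passed. *)
Definition crossing_value (i : nat) (x : nat * nat * nat) : F2 :=
  let: (a, b, c) := x in
  if (b == i) && (a == i.+1) then gen_a
  else if (c == i) && (b == i.+1) then gen_b
  else if (c == i) && (a == i.+1) then
    if b < i then (gen_a * gen_b)^-1 else (gen_b * gen_a)^-1
  else 1.

Definition swap3 (i : nat) (x : nat * nat * nat) :=
  let: (a, b, c) := x in (swap_pos i a, swap_pos i b, swap_pos i c).

Lemma swap_posK i : involutive (swap_pos i).
Proof.
move=> k; rewrite /swap_pos; have [->|ki] := eqVneq k i.
  by rewrite eqxx -[_.+1 == _]/(_ == _); case: eqP => //; lia.
have [->|ki1] := eqVneq k i.+1; first by rewrite eqxx.
by rewrite (negbTE ki) (negbTE ki1).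
Qed.

Lemma swap3K i : involutive (swap3 i).
Proof. by move=> [[a b] c]; rewrite /swap3 !swap_posK. Qed.

Lemma near_cases i k : [\/ k = i, k = i.+1, k = i.+2 |
  [/\ (k == i) = false, (k == i.+1) = false, (k == i.+2) = false
    & (k < i.+1) = (k < i)]].
Proof.
have [->|k0] := eqVneq k i; first exact: Or41.
have [->|k1] := eqVneq k i.+1; first exact: Or42.
have [->|k2] := eqVneq k i.+2; first exact: Or43.
by apply: Or44; split=> //; lia.
Qed.

Lemma nearE i :
  ((i.+1 == i = false) * (i.+2 == i = false) * (i.+2 == i.+1 = false) *
  (i == i.+1 = false) * (i == i.+2 = false) * (i.+1 == i.+2 = false) *
  (i < i.+1 = true) * (i.+1 < i = false) * (i.+2 < i = false) *
  (i.+2 < i.+1 = false))%type.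
Proof. by do !split; lia. Qed.

Lemma swap_near i k : swap_pos i (swap_pos i.+1 (swap_pos i k)) =
  swap_pos i.+1 (swap_pos i (swap_pos i.+1 k)).
Proof.
rewrite /swap_pos; case: (near_cases i k) => [->|->|->|[h0 h1 h2 _]].
1-3: by do 3 rewrite ?(nearE, eqxx) /=.
by do 3 rewrite ?(h0, h1, h2) /=.
Qed.

(** Only the places of the three strands relative to [i], [i.+1] and [i.+2]
    matter, which leaves 64 cases. *)
Lemma crossing_value_near i x :
  crossing_value i x * crossing_value i.+1 (swap3 i x) *
    crossing_value i (swap3 i.+1 (swap3 i x)) =
  crossing_value i.+1 x * crossing_value i (swap3 i.+1 x) *
    crossing_value i.+1 (swap3 i (swap3 i.+1 x)).
Proof.
case: x => [[a b] c]; rewrite /crossing_value /swap3 /swap_pos.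
case: (near_cases i a) => [->|->|->|[a0 a1 a2 a3]];
  case: (near_cases i b) => [->|->|->|[b0 b1 b2 b3]];
  case: (near_cases i c) => [->|->|->|[c0 c1 c2 c3]].
all: do 4 (rewrite ?(nearE, eqxx) /=; try rewrite ?(a0, a1, a2) /=;
  try rewrite ?(b0, b1, b2, b3) /=; try rewrite ?(c0, c1, c2) /=).
all: rewrite ?(mul1g, mulg1) //.
all: by rewrite !invgM !mulgA ?(mulgV, mulVg, mul1g, mulgVK, mulgK).
Qed.

(** The crossings take place at disjoint pairs of positions.  A nontrivial value
    requires two of the three strands at the pair in question, so one of the
    two values is [1]. *)
Lemma crossing_value_far i j x : i.+1 < j ->
  [/\ crossing_value j (swap3 i x) = crossing_value j x,
    crossing_value i (swap3 j x) = crossing_value i x &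
    commute (crossing_value i x) (crossing_value j x)].
Proof.
move=> ij; case: x => [[a b] c].
have neq k l : (k < l) || (l < k) -> (k == l) = false by lia.
have far k : [/\ (swap_pos i k == j) = (k == j), (swap_pos i k == j.+1) = (k == j.+1),
    (swap_pos j k == i) = (k == i), (swap_pos j k == i.+1) = (k == i.+1)
    & ((swap_pos i k < j) = (k < j)) * ((swap_pos j k < i) = (k < i))].
  rewrite /swap_pos; have [->|k0] := eqVneq k i.
    by rewrite !(neq i j) ?(neq i j.+1) ?(neq i.+1 j) ?(neq i.+1 j.+1); do ?split; lia.
  have [->|k1] := eqVneq k i.+1.
    by rewrite ?(neq i.+1 j) ?(neq i j) ?(neq i j.+1) ?(neq i.+1 j.+1); do ?split; lia.
  have [->|k2] := eqVneq k j; first by do ?split; lia.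
  have [->|k3] := eqVneq k j.+1; first by do ?split; lia.
  by do ?split; lia.
have [a1 a2 a3 a4 _] := far a; have [b1 b2 b3 b4 [b5 b6]] := far b.
have [c1 c2 c3 c4 _] := far c; rewrite /crossing_value /swap3.
split; first by rewrite a2 b1 b2 b5 c1.
  by rewrite a4 b3 b4 b6 c3.
clear -ij; case: ifP => [/andP[/eqP ? /eqP ?]|_]; last
  (case: ifP => [/andP[/eqP ? /eqP ?]|_]; last
   (case: ifP => [/andP[/eqP ? /eqP ?]|_]; last exact/commute_sym/commute1)).
all: rewrite [X in commute _ X](_ : _ = 1); first exact: commute1.
all: by do 3 (case: ifP => [/andP[/eqP ? /eqP ?]|_]; first lia).
Qed.

Lemma swap3_far i j x : i.+1 < j -> swap3 j (swap3 i x) = swap3 i (swap3 j x).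
Proof.
move=> ij; have h k : swap_pos j (swap_pos i k) = swap_pos i (swap_pos j k).
  have out l r : r <> l -> r <> l.+1 -> swap_pos l r = r.
    by move=> /eqP/negbTE n1 /eqP/negbTE n2; rewrite /swap_pos n1 n2.
  have at0 l : swap_pos l l = l.+1 by rewrite /swap_pos eqxx.
  have at1 l : swap_pos l l.+1 = l by rewrite /swap_pos eqxx ifN_eq //; lia.
  have [->|k0] := eqVneq k i; first by rewrite at0 !(out j) ?at0 //; lia.
  have [->|k1] := eqVneq k i.+1; first by rewrite at1 !(out j) ?at1 //; lia.
  rewrite (out i k); try lia.
  have [->|k2] := eqVneq k j; first by rewrite at0 out //; lia.
  have [->|k3] := eqVneq k j.+1; first by rewrite at1 out //; lia.
  by rewrite (out j k) ?out //; lia.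
by case: x => [[a b] c]; rewrite /swap3 !h.
Qed.

Lemma swap3_near i x :
  swap3 i (swap3 i.+1 (swap3 i x)) = swap3 i.+1 (swap3 i (swap3 i.+1 x)).
Proof. by case: x => [[a b] c]; rewrite /swap3 !swap_near. Qed.

(** The braid group acts on arrangements of the three strands together with an
    element of the free group in which the values of the crossings are
    collected; inverse letters undo the step of the generator. *)
Definition step n (u : nat * nat * nat * F2) (l : letter 'I_n) :=
  let y := swap3 l.1 u.1 in
  (y, if l.2 then u.2 * (crossing_value l.1 y)^-1 else u.2 * crossing_value l.1 u.1).

Definition run n (s : seq (letter 'I_n)) u := foldl (@step n) u s.

Lemma step_flip n (l : letter 'I_n) u : step (step u l) (flip l) = u.
Proof.
case: u l => x f [i []]; rewrite /step /= !swap3K; first by rewrite mulgVK.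
by rewrite mulgK.
Qed.

Lemma run_pres_eq n s t : pres_eq (@braid_rel n) s t -> run s =1 run t.
Proof.
elim=> {s t} [//|s t _ IH u|s t v _ IH1 _ IH2 u|s t l u|s t v v' vv' u].
- by rewrite IH.
- by rewrite IH1 IH2.
- by rewrite /run !foldl_cat /= step_flip.
rewrite /run !foldl_cat; congr foldl; move: (foldl _ _ s) => {}u {s t}.
case: vv' => i j ij; case: u => x f; rewrite /= /step /=.
  have [e1 e2 cij] := crossing_value_far x ij.
  by rewrite swap3_far // e1 e2 -!mulgA cij.
rewrite -ij swap3_near; congr pair; rewrite -!mulgA; congr mulg.
by rewrite !mulgA crossing_value_near.
Qed.

Lemma run_mull n (s : seq (letter 'I_n)) x g f :
  run s (x, g * f) = ((run s (x, f)).1, g * (run s (x, f)).2).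
Proof.
elim: s x f => [//|l s IH] x f; rewrite /run /= /step /=.
by case: l => i [] /=; rewrite -mulgA -!/(run s _) IH.
Qed.

Lemma val_crossing n (i : 'I_n.-1) (k : 'I_n) :
  crossing_perm i k = swap_pos i k :> nat.
Proof.
rewrite /crossing_perm /swap_pos; case: tpermP => [->|->|/eqP k1 /eqP k2] /=.
- by rewrite eqxx.
- by rewrite eqxx; case: eqP => //; lia.
have -> : (k == i :> nat) = false.
  by apply: contraNF k1 => /eqP e; apply/eqP/val_inj.
have -> // : (k == i.+1 :> nat) = false.
by apply: contraNF k2 => /eqP e; apply/eqP/val_inj.
Qed.

Lemma run_positions n (s : seq (letter 'I_n.-1)) (a b c : 'I_n) f :
  let p := string_eval (@crossing_perm n) s in
  (run s ((a : nat, b : nat, c : nat), f)).1 = (p a : nat, p b : nat, p c : nat).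
Proof.
elim: s a b c f => [|l s IH] a b c f; first by rewrite /= /string_eval big_nil !perm1.
have -> : string_eval (@crossing_perm n) (l :: s) =
    crossing_perm l.1 * string_eval (@crossing_perm n) s.
  rewrite /string_eval big_cons; congr mulg; rewrite /letter_eval.
  by case: l.2 => //; rewrite tpermV.
rewrite /= !permM -(IH _ _ _ (step ((a : nat, b : nat, c : nat), f) l).2).
by rewrite /run /= /step /= !val_crossing.
Qed.

Definition start : nat * nat * nat * F2 := ((0%N, 1%N, 2%N), 1).

Definition strand_value n (x : braid_group n) : F2 :=
  (run (pres_repr x) start).2.

Lemma strand_value_class n s :
  strand_value (pres_class (@braid_rel n) s) = (run s start).2.
Proof. by congr snd; exact: run_pres_eq (pres_classK _ s) _. Qed.

(** After a pure braid the three strands are back in their positions. *)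
Lemma strand_valueM n (x y : braid_group n) : 3 <= n -> braid_perm x = 1 ->
  strand_value (x * y) = strand_value x * strand_value y.
Proof.
move=> n3 x1; rewrite [LHS]strand_value_class /run foldl_cat -!/(run _ _).
pose a := Ordinal (ltn_trans (isT : 0 < 2) n3).
pose b := Ordinal (ltn_trans (isT : 1 < 2) n3).
have := run_positions (pres_repr x) a b (Ordinal n3) 1.
cbv zeta; rewrite (x1 : string_eval _ (pres_repr x) = 1) !perm1 => pos1.
rewrite /strand_value; case: (run (pres_repr x) start) pos1 => [x' f] /= ->.
by rewrite -{1}[f]mulg1 run_mull.
Qed.

Definition pure_strand_value n (x : pure_braid_group n) : F2 :=
  strand_value (val x).

Lemma pure_strand_valueM n : 3 <= n -> {morph @pure_strand_value n : x y / x * y}.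
Proof.
move=> n3 x y; have vM : val (x * y) = val x * val y := valM x y.
rewrite /pure_strand_value vM strand_valueM //; apply/eqP; exact: (valP x).
Qed.

(** The full twists of the first two and of the next two strands have the
    values [gen_a] and [gen_b]. *)
Lemma pure_strand_value_noncommuting n : 3 <= n ->
  exists x y : pure_braid_group n, ~ commute (pure_strand_value x) (pure_strand_value y).
Proof.
move=> n3; have i0 : 0 < n.-1 by lia.
have i1 : 1 < n.-1 by lia.
have full_twist (i : 'I_n.-1) : exists x : pure_braid_group n,
    val x = pres_class (@braid_rel n) [:: pos i; pos i].
  suff h : pure_braid_pred n (pres_class (@braid_rel n) [:: pos i; pos i]).
    by exists (exist (fun y : braid_group n => pure_braid_pred n y) _ h).
  apply/eqP; rewrite [LHS](pres_lift_class (@crossing_perm_rel n)).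
  by rewrite /string_eval !big_cons big_nil mulg1 /letter_eval /= tperm2.
have [x xE] := full_twist (Ordinal i0); have [y yE] := full_twist (Ordinal i1).
exists x, y; rewrite /pure_strand_value xE yE !strand_value_class /=.
by rewrite /step /= !mul1g; exact: gen_a_gen_b_neq.
Qed.
End Braids.

(** * Right angled Artin groups *)

Lemma pres_class_string_eval (T : choiceType) R (s : seq (letter T)) :
  pres_class R s = string_eval (@pres_gen T R) s.
Proof.
elim: s => [|l s IH]; first by rewrite /string_eval big_nil.
rewrite -cat1s pres_class_cat IH /string_eval big_cons; congr mulg.
case: l => x [] //; rewrite /letter_eval /= /pres_gen.
apply: (@mulgI _ (pres_class R [:: pos x])); rewrite mulgV -pres_class_cat.
by apply/pres_class_eq; exact: (pres_eq_mulV R [:: pos x]).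
Qed.

Lemma commute_string_eval (T : Type) (G : groupType) (g : T -> G) (x : G) s :
  (forall i, commute x (g i)) -> commute x (string_eval g s).
Proof.
move=> cx; apply: commute_prod => l _; rewrite /letter_eval.
by case: l.2; [apply: commuteV|].
Qed.

(** Some two distinct vertices are not adjacent, since otherwise all generators
    commute; the other vertices are sent to [1]. *)
Lemma raag_two_generators (V : finType) (e : rel V) :
  symmetric e -> ~ abelian_group (raag e) ->
  exists f : raag e -> free_group bool, {morph f : x y / (x * y)%g} /\
    exists x y, ~ commute (f x) (f y).
Proof.
move=> sym nab.
have [u [v [uv euv]]] : exists u v, u != v /\ ~~ e u v.
  apply: contrapT => all_adj; apply: nab => x y.
  rewrite -(pres_reprK x) -(pres_reprK y) !pres_class_string_eval.
  apply: commute_string_eval => i; apply/commute_sym/commute_string_eval => j.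
  have [->|ij] := eqVneq i j; first exact: commute_refl.
  have eij : e i j by apply: contrapT => /negP nij; apply: all_adj; exists i, j.
  rewrite /commute /pres_gen -!pres_class_cat; apply/pres_class_eq.
  exact: (pres_eq_rel [::] [::] (raag_comm eij)).
pose g x := if x == u then gen_a else if x == v then gen_b else 1%g.
have gR a b : raag_rel e a b -> string_eval g a = string_eval g b.
  case=> {a b} a b eab; rewrite /string_eval !big_cons !big_nil !mulg1 /letter_eval /=.
  suff : commute (g a) (g b) by [].
  rewrite /g; have [ea|_] := eqVneq a u; have [eb|_] := eqVneq b u.
  - exact: commute_refl.
  - by have [eb'|_] := eqVneq b v; [rewrite -ea -eb' eab in euv|exact: commute1].
  - have [ea'|_] := eqVneq a v; last exact/commute_sym/commute1.
    by rewrite -ea' -eb sym eab in euv.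
  - have [_|_] := eqVneq a v; last exact/commute_sym/commute1.
    by have [_|_] := eqVneq b v; [exact: commute_refl|exact: commute1].
exists (pres_lift g); split; first exact: pres_liftM.
exists (pres_gen _ u), (pres_gen _ v); rewrite !pres_lift_gen // /g eqxx.
rewrite eq_sym (negbTE uv) eqxx; exact: gen_a_gen_b_neq.
Qed.

(** * Conclusion *)

Lemma verbal_set_not_rational_iso (H K : groupType) (X : choiceType)
    (f : K -> free_group X) (w : word) :
  isomorphic_groups H K -> {morph f : x y / (x * y)%g} ->
  (exists x y, ~ commute (f x) (f y)) ->
  proper_word w -> ~ rational (verbal_set w H).
Proof.
move=> [phi [psi _ psiK]] fM [x [y nxy]]; rewrite -(psiK x) -(psiK y) in nxy.
apply: (verbal_set_not_rational (f := f \o phi)) nxy => u v /=.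
by rewrite gmulfM fM.
Qed.

Theorem corollary5p12 (H : groupType) :
  (exists n : nat, (3 <= n)%N /\ isomorphic_groups H (pure_braid_group n)) \/
  (exists (V : finType) (e : rel V),
     [/\ symmetric e, irreflexive e, isomorphic_groups H (raag e)
       & ~ abelian_group H]) \/
  [/\ finitely_generated H, ~ abelian_group H & residually_free H] ->
  forall w : word, proper_word w -> ~ rational (verbal_set w H).
Proof.
move=> + w pw; case=> [[n [n3 HP]]|[[V [e [sym _ He nab]]]|[_ nab rf]]].
- apply: (verbal_set_not_rational_iso HP (pure_strand_valueM n3)) => //.
  exact: pure_strand_value_noncommuting.
- have nabe : ~ abelian_group (raag e).
    case: He => phi [psi phiK _] ab; apply: nab => x y.
    by apply: (can_inj phiK); rewrite !gmulfM; exact: ab.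
  have [f [fM nc]] := raag_two_generators sym nabe.
  exact: (verbal_set_not_rational_iso He fM nc).
have [x [y nxy]] : exists x y : H, ~ commute x y.
  by move: nab => /existsNP[x /existsNP[y nxy]]; exists x, y.
have [X [f fh]] : exists (X : choiceType) (f : UMagmaMorphism.type H (free_group X)),
    f [~ x, y]%g <> 1%g.
  apply: rf => /(congr1 (fun z => y * (x * z))%g).
  by rewrite /commg /conjg mulg1 !mulVKg.
apply: (verbal_set_not_rational (f := f) (h := x) (k := y)) pw; first exact: gmulfM.
by move=> fc; apply: fh; rewrite gmulfR /commg /conjg fc mulKg mulVg.
Qed.
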